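(* Let $\mathcal{B}=\bigoplus_{n\ge0}\mathcal{B}_n$, where $\mathcal{B}_n$ is the complex vector space freely spanned by isomorphism classes of binary delta-matroids whose ground set has $n$ elements. With the multiplication given by direct sum, unit $(\emptyset;\{\emptyset\})$, comultiplication $\mu(D)=\sum_{E'\subseteq E}D_{E'}\otimes D_{E\setminus E'}$, and counit equal to the identification $\mathcal{B}_0\cong\mathbb{C}$ on $\mathcal{B}_0$ and zero on $\mathcal{B}_i$, $i\ge1$, the space $\mathcal{B}$ is a graded commutative cocommutative Hopf algebra. Moreover the subspace $\mathcal{B}^e\subseteq\mathcal{B}$ spanned by even binary delta-matroids is a Hopf subalgebra.
   Context: A set system $(E;\Phi)$ is a finite set $E$ with a nonempty family $\Phi\subseteq 2^E$ of feasible sets, considered up to isomorphism. For $E'\subseteq E$ the twist is $D*E'=(E;\{\phi\Delta E'\mid\phi\in\Phi\})$. A framed graph is a simple graph $G$ with a map $f:V(G)\to\{0,1\}$; its adjacency matrix over $\mathbb{F}_2$ has diagonal entry $f(v)$ at $v$ and the usual off-diagonal entries. The nondegeneracy delta-matroid of $G$ is $(V(G);\{U\subseteq V(G)\mid$ the adjacency matrix of the induced framed subgraph $G_U$ is nondegenerate over $\mathbb{F}_2\})$ (the empty matrix counts as nondegenerate). A binary delta-matroid is a set system isomorphic to a twist of the nondegeneracy delta-matroid of a framed graph. A delta-matroid is even if all feasible sets have cardinalities of the same parity. Direct sum of set systems with disjoint ground sets: $(E_1;\Phi_1)(E_2;\Phi_2)=(E_1\sqcup E_2;\{\phi_1\sqcup\phi_2\mid\phi_i\in\Phi_i\})$.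 For $D=(E;\Phi)$: $e$ is a coloop if it lies in every feasible set, a loop if in none; for non-coloop $e$, $D\setminus e=(E\setminus\{e\};\{\phi\in\Phi\mid e\notin\phi\})$; for non-loop $e$, $D/e=(E\setminus\{e\};\{\phi\setminus\{e\}\mid e\in\phi\in\Phi\})$; for a coloop $e$, $D\setminus e:=D/e$. The restriction $D_{E'}$ is obtained by deleting all elements of $E\setminus E'$. *)

(* Defs.v *)
From HB Require Import structures.
From mathcomp Require Import all_boot all_order all_algebra all_fingroup.
From mathcomp Require Import freeg.
From mathcomp Require Import complex.
From Stdlib Require Rdefinitions.
From mathcomp Require Import Rstruct.

Set Implicit Arguments.
Unset Strict Implicit.
Unset Printing Implicit Defensive.

Import GRing.Theory.
Local Open Scope ring_scope.

Definition CC : fieldType := complex Rdefinitions.R.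

(* Set systems.  A set system with an n-element ground set is, up to    *)
(* isomorphism, a family of subsets of 'I_n.                            *)
Notation setsys n := {set {set 'I_n}}.

Definition key := {n : nat & setsys n}.
Definition mkkey n (F : setsys n) : key := Tagged (fun m => setsys m) F.

Definition relabel n (s : {perm 'I_n}) (F : setsys n) : setsys n :=
  [set (s @: X) | X : {set 'I_n} in F].

Definition iso_ss n (F G : setsys n) : bool :=
  [exists s : {perm 'I_n}, G == relabel s F].

Definition iso_class n (F : setsys n) : {set setsys n} := [set G | iso_ss F G].
Definition canon n (F : setsys n) : setsys n := odflt F [pick G in iso_class F].
Definition canon_key (k : key) : key := mkkey (canon (tagged k)).

Definition twist n (F : setsys n) (E' : {set 'I_n}) : setsys n :=
  [set ((X :\: E') :|: (E' :\: X)) | X : {set 'I_n} in F].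

(* Framed graphs on the vertex set 'I_n: a simple graph (symmetric      *)
(* irreflexive relation e) together with a framing f : 'I_n -> {0,1}.   *)
Definition simple_graph n (e : rel 'I_n) : bool :=
  [forall i, forall j, e i j == e j i] && [forall i, ~~ e i i].

Definition framed_adj n (e : rel 'I_n) (f : 'I_n -> bool) : 'M['F_2]_n :=
  \matrix_(i, j) (if i == j then (f i)%:R else (e i j)%:R).

Definition induced_mx n (A : 'M['F_2]_n) (U : {set 'I_n}) : 'M['F_2]_#|U| :=
  \matrix_(i, j) A (enum_val i) (enum_val j).

Definition nondeg_dm n (e : rel 'I_n) (f : 'I_n -> bool) : setsys n :=
  [set U : {set 'I_n} | \det (induced_mx (framed_adj e f) U) != 0].

Definition binary_dm n (F : setsys n) : Prop :=
  exists (e : rel 'I_n) (f : 'I_n -> bool) (E' : {set 'I_n}) (s : {perm 'I_n}),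
    simple_graph e /\ F = relabel s (twist (nondeg_dm e f) E').

Definition even_ss n (F : setsys n) : bool :=
  [forall X in F, forall Y in F, odd #|X| == odd #|Y|].

(* D \ x, keeping x in the ground set (it then lies in no feasible set);
   if x is a coloop, D \ x := D / x. *)
Definition del1 n (F : setsys n) (x : 'I_n) : setsys n :=
  if [forall X in F, x \in X] then [set (X :\ x) | X : {set 'I_n} in F]
  else [set X in F | x \notin X].

Definition del_set n (F : setsys n) (Z : {set 'I_n}) : setsys n :=
  foldl (@del1 n) F (enum Z).

Definition restrict n (F : setsys n) (E' : {set 'I_n}) : setsys #|E'| :=
  [set [set i : 'I_#|E'| | enum_val i \in X] | X : {set 'I_n} in del_set F (~: E')].

Definition dsum n m (F : setsys n) (G : setsys m) : setsys (n + m) :=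
  [set ((@lshift n m @: X) :|: (@rshift n m @: Y)) | X : {set 'I_n} in F, Y : {set 'I_m} in G].

(* Basis elements of B: isomorphism classes of binary delta-matroids,   *)
(* each represented by its canonical representative.                   *)
Definition basis_key (k : key) : Prop :=
  binary_dm (tagged k) /\ canon (tagged k) = tagged k.
Definition even_key (k : key) : Prop := basis_key k /\ even_ss (tagged k).

(* The ambient free vector spaces over CC (B, B (x) B, B (x) B (x) B are
   the subspaces spanned by basis keys, resp. pairs / triples of them). *)
Notation V := {freeg key / CC}.
Notation V2 := {freeg (key * key) / CC}.
Notation V3 := {freeg (key * (key * key)) / CC}.

Definition inB (x : V) : Prop := forall k, coeff k x != 0 -> basis_key k.
Definition inBn (d : nat) (x : V) : Prop :=
  forall k, coeff k x != 0 -> basis_key k /\ tag k = d.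
Definition inBe (x : V) : Prop := forall k, coeff k x != 0 -> even_key k.
Definition inB2 (x : V2) : Prop :=
  forall p, coeff p x != 0 -> basis_key p.1 /\ basis_key p.2.
Definition inBe2 (x : V2) : Prop :=
  forall p, coeff p x != 0 -> even_key p.1 /\ even_key p.2.

Definition tens (A B : choiceType) (x : {freeg A / CC}) (y : {freeg B / CC})
  : {freeg (A * B) / CC} :=
  fglift (fun a => fglift (fun b => << (a, b) >>) y) x.

Definition key_mul (k l : key) : key := canon_key (mkkey (dsum (tagged k) (tagged l))).
Definition mulB (x y : V) : V :=
  fglift (fun k => fglift (fun l => << key_mul k l >>) y) x.

Definition unit_key : key := @mkkey 0 [set set0].
Definition unitB : V := << unit_key >>.

Definition comul_key (k : key) : V2 :=
  \sum_(E' : {set 'I_(tag k)})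
     << (canon_key (mkkey (restrict (tagged k) E')),
         canon_key (mkkey (restrict (tagged k) (~: E')))) >>.
Definition comulB (x : V) : V2 := fglift comul_key x.

Definition counitB (x : V) : CC :=
  fglift (fun k : key => (if tag k == 0%N then 1 else 0) : CC^o) x.

Definition mul2 (X Y : V2) : V2 :=
  fglift (fun p => fglift (fun q =>
     tens (mulB << p.1 >> << q.1 >>) (mulB << p.2 >> << q.2 >>)) Y) X.

Definition comul_id (X : V2) : V3 :=
  fglift (fun p => fglift (fun q : key * key => << (q.1, (q.2, p.2)) >>)
                          (comulB << p.1 >>)) X.
Definition id_comul (X : V2) : V3 :=
  fglift (fun p => tens << p.1 >> (comulB << p.2 >>)) X.

Definition flip2 (X : V2) : V2 := fglift (fun p => << (p.2, p.1) >>) X.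

Definition counit_id (X : V2) : V :=
  fglift (fun p => counitB << p.1 >> *: << p.2 >>) X.
Definition id_counit (X : V2) : V :=
  fglift (fun p => counitB << p.2 >> *: << p.1 >>) X.

Definition mul_S_id (S : V -> V) (X : V2) : V :=
  fglift (fun p => mulB (S << p.1 >>) << p.2 >>) X.
Definition mul_id_S (S : V -> V) (X : V2) : V :=
  fglift (fun p => mulB << p.1 >> (S << p.2 >>)) X.

Definition graded_comm_cocomm_hopf : Prop :=
  inB unitB /\
  (forall x y, inB x -> inB y -> inB (mulB x y)) /\
  (forall x, inB x -> inB2 (comulB x)) /\
  inBn 0 unitB /\
  (forall m n x y, inBn m x -> inBn n y -> inBn (m + n) (mulB x y)) /\
  (forall n x, inBn n x -> forall p, coeff p (comulB x) != 0 ->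
       (tag p.1 + tag p.2)%N = n) /\
  (forall n x, (0 < n)%N -> inBn n x -> counitB x = 0) /\
  (forall x y z, inB x -> inB y -> inB z ->
       mulB (mulB x y) z = mulB x (mulB y z)) /\
  (forall x, inB x -> mulB unitB x = x /\ mulB x unitB = x) /\
  (forall x y, inB x -> inB y -> mulB x y = mulB y x) /\
  (forall x, inB x -> comul_id (comulB x) = id_comul (comulB x)) /\
  (forall x, inB x -> counit_id (comulB x) = x /\ id_counit (comulB x) = x) /\
  (forall x, inB x -> flip2 (comulB x) = comulB x) /\
  (forall x y, inB x -> inB y ->
       comulB (mulB x y) = mul2 (comulB x) (comulB y)) /\
  comulB unitB = tens unitB unitB /\
  (forall x y, inB x -> inB y -> counitB (mulB x y) = counitB x * counitB y) /\
  counitB unitB = 1 /\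
  (exists S : {linear V -> V},
     (forall x, inB x -> inB (S x)) /\
     (forall x, inB x ->
        mul_S_id S (comulB x) = counitB x *: unitB /\
        mul_id_S S (comulB x) = counitB x *: unitB)).

Definition even_hopf_subalgebra : Prop :=
  inBe unitB /\
  (forall x y, inBe x -> inBe y -> inBe (mulB x y)) /\
  (forall x, inBe x -> inBe2 (comulB x)) /\
  (forall S : {linear V -> V},
     (forall x, inB x -> inB (S x)) ->
     (forall x, inB x ->
        mul_S_id S (comulB x) = counitB x *: unitB /\
        mul_id_S S (comulB x) = counitB x *: unitB) ->
     forall x, inBe x -> inBe (S x)).

(* Main.v *)
(* A binary delta-matroid is a family { Y | Y + X in nd A } for a symmetric A over
   F_2 (+ the symmetric difference). Principal pivoting lets any feasible set serve
   as the base X. Based at an X avoiding x (or at any X when x is a coloop),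
   deleting x amounts to deleting the vertex x from A, so binarity is preserved;
   basing at X also reduces the symmetric exchange axiom to the observation that a
   nondegenerate matrix has no zero row. The exchange axiom in turn makes deletions
   commute even when coloops appear along the way, so D_E' does not depend on the
   order of deletion, and all bialgebra identities become reindexings of sums over
   subsets. The antipode is obtained by recursion on the size of the ground set;
   the same recursion shows that every antipode preserves the even part. *)
Require Import Defs.
From HB Require Import structures.
From mathcomp Require Import all_boot all_order all_algebra all_fingroup.
From mathcomp Require Import freeg.

Set Implicit Arguments.
Unset Strict Implicit.
Unset Printing Implicit Defensive.

Import GRing.Theory.
Local Open Scope ring_scope.

(** Deletion is specified as a fold along [enum], and a relabelling does not respect that order; so
    the mere fact that D_E' depends only on isomorphism classes already rests on the commutation of
    deletions. For general set systems commutation fails: in {{x},{y,z}} deleting x and then the new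
    coloop y leaves {{z}}, while deleting y and then the new coloop x leaves the family of the empty
    set alone. This is why the exchange axiom is needed so early. Comparing restrictions of
    restrictions, or of sums, on ordinals would require renumbering at every step. Instead all
    families live in one ambient finite type, are moved there along injections, and are turned into
    classes only at the end. Nondegeneracy is rephrased as injectivity of a map that applies the
    matrix on the coordinates in U and is the identity elsewhere. A principal pivot then is a change
    of variables, and its effect on all minors is checked coordinate by coordinate. Products land on
    canonical representatives, so the unit law is a statement about canonical keys; identities are
    therefore proved on basis keys and extended linearly to vectors supported there. *)

Section FreeModule.
Variable (R : comNzRingType).

(** * Linear extension from the basis of a free module, and supports *)

Section Lift.
Variables (K : choiceType) (M : lmodType R).
Implicit Types (f g : K -> M) (x y : {freeg K / R}).

Lemma fglift_sumE f x : fglift f x = \sum_(k <- dom x) coeff k x *: f k.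
Proof. by rewrite -{1}[x]Freeg_dom fglift_Freeg /prelift big_map. Qed.

Lemma fglift_is_additive f : {morph fglift f : x y / x - y}.
Proof. exact: lift_is_additive. Qed.

HB.instance Definition _ f :=
  GRing.isAdditive.Build {freeg K / R} M (fglift f) (fglift_is_additive f).

Lemma fglift_is_scalable f : scalable (fglift f).
Proof.
move=> c x; rewrite -{1}[x]freeg_sumE scaler_sumr raddf_sum fglift_sumE scaler_sumr.
apply: eq_bigr => k _ /=.
have -> : c *: << coeff k x *g k >> = << c * coeff k x *g k >> :> {freeg K / R}.
  by apply/eqP/freeg_eqP => l; rewrite coeffZ !coeffU mulrA.
by rewrite liftU scalerA.
Qed.

HB.instance Definition _ f :=
  GRing.isScalable.Build R {freeg K / R} M *:%R (fglift f) (fglift_is_scalable f).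

Lemma fgliftU1 f k : fglift f << k >> = f k.
Proof. by rewrite liftU scale1r. Qed.

Lemma fglift_sumU f (I : Type) (r : seq I) (P : pred I) (p : I -> K) :
  fglift f (\sum_(i <- r | P i) << p i >>) = \sum_(i <- r | P i) f (p i).
Proof.
by rewrite raddf_sum; apply: eq_bigr => i _; rewrite /= fgliftU1.
Qed.

Lemma fglift0 x : fglift (fun _ : K => 0 : M) x = 0.
Proof. by rewrite fglift_sumE big1 // => k _; rewrite scaler0. Qed.

Lemma fgliftZf c f x : fglift (fun k => c *: f k) x = c *: fglift f x.
Proof.
rewrite !fglift_sumE scaler_sumr; apply: eq_bigr => k _.
by rewrite !scalerA mulrC.
Qed.

End Lift.

Lemma fglift_linear (K : choiceType) (M N : lmodType R) (h : {linear M -> N})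
    (f : K -> M) (x : {freeg K / R}) :
  h (fglift f x) = fglift (fun k => h (f k)) x.
Proof.
rewrite !fglift_sumE linear_sum; apply: eq_bigr => k _.
by rewrite linearZ.
Qed.

Lemma fglift_exchange (K L : choiceType) (M : lmodType R) (h : K -> L -> M)
    (x : {freeg K / R}) (y : {freeg L / R}) :
  fglift (fun k => fglift (h k) y) x = fglift (fun l => fglift (h^~ l) x) y.
Proof.
rewrite !fglift_sumE.
under eq_bigr do rewrite fglift_sumE scaler_sumr.
rewrite exchange_big; apply: eq_bigr => l _.
rewrite fglift_sumE scaler_sumr; apply: eq_bigr => k _.
by rewrite !scalerA mulrC.
Qed.

Lemma fgliftU_id (K : choiceType) (x : {freeg K / R}) :
  fglift (fun k => << k >>) x = x.
Proof.
rewrite fglift_sumE -[RHS]freeg_sumE; apply: eq_bigr => k _.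
by apply/eqP/freeg_eqP => l; rewrite coeffZ !coeffU mul1r.
Qed.

(** [inB], [inBn], [inBe], [inB2] and [inBe2] are instances by conversion, so the closure lemmas
    below apply to them directly. *)
Definition supp (K : choiceType) (P : K -> Prop) (x : {freeg K / R}) : Prop :=
  forall k, coeff k x != 0 -> P k.

Section Support.
Variables (K : choiceType) (P : K -> Prop).
Implicit Types x y : {freeg K / R}.

Lemma supp0 : supp P 0.
Proof. by move=> k; rewrite coeff0 eqxx. Qed.

Lemma suppD x y : supp P x -> supp P y -> supp P (x + y).
Proof.
move=> Px Py k; rewrite coeffD.
have [x0|/Px //] := eqVneq (coeff k x) 0.
by rewrite x0 add0r => /Py.
Qed.

Lemma suppN x : supp P x -> supp P (- x).
Proof. by move=> Px k; rewrite coeffN oppr_eq0 => /Px. Qed.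

Lemma suppZ c x : supp P x -> supp P (c *: x).
Proof.
move=> Px k; rewrite coeffZ; have [->|/Px //] := eqVneq (coeff k x) 0.
by rewrite mulr0 eqxx.
Qed.

Lemma supp_sum (I : Type) (r : seq I) (Q : pred I) (F : I -> {freeg K / R}) :
  (forall i, Q i -> supp P (F i)) -> supp P (\sum_(i <- r | Q i) F i).
Proof. by move=> h; elim/big_ind: _ => //; [exact: supp0|exact: suppD]. Qed.

Lemma suppU k : P k -> supp P << k >>.
Proof. by move=> Pk l; rewrite coeffU; case: (k =P l) => [<- //|]; rewrite mulr0 eqxx. Qed.

Lemma eq_fglift (M : lmodType R) (f g : K -> M) x :
  supp P x -> (forall k, P k -> f k = g k) -> fglift f x = fglift g x.
Proof.
move=> Px e; rewrite !fglift_sumE !big_seq; apply: eq_bigr => k.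
by rewrite mem_dom => /Px /e ->.
Qed.

End Support.

Lemma supp_fglift (K L : choiceType) (P : K -> Prop) (Q : L -> Prop)
    (f : K -> {freeg L / R}) (x : {freeg K / R}) :
  supp P x -> (forall k, P k -> supp Q (f k)) -> supp Q (fglift f x).
Proof.
move=> Px h; rewrite fglift_sumE big_seq; apply: supp_sum => k.
by rewrite mem_dom => /Px /h /suppZ.
Qed.

End FreeModule.

Arguments fgliftU1 {R K M} f k.

(** * Deletion in set families over a fixed finite type *)

Section Families.
Variable T : finType.
Implicit Types (F G : {set {set T}}) (X Y Z E : {set T}) (s : seq T) (x y : T).

Definition coloop F x := [forall X in F, x \in X].

(** Convertible to [del1] when the type is an ordinal. *)
Definition ldel F x : {set {set T}} :=
  if coloop F x then [set X :\ x | X : {set T} in F]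
  else [set X in F | x \notin X].

Definition dels F Z := foldl ldel F (enum Z).

Definition supported F E : Prop := forall X, X \in F -> X \subset E.

Definition symdiff X Y := (X :\: Y) :|: (Y :\: X).

(** The symmetric exchange axiom; [v = u] is allowed and flips a single element. *)
Definition delta_matroid F : Prop :=
  F != set0 /\
  forall X Y u, X \in F -> Y \in F -> u \in symdiff X Y ->
    exists2 v, v \in symdiff X Y & symdiff X [set u; v] \in F.

Lemma in_symdiff X Y x : (x \in symdiff X Y) = (x \in X) (+) (x \in Y).
Proof. by rewrite !inE; case: (x \in X); case: (x \in Y). Qed.

Lemma coloopP F x : reflect (forall X, X \in F -> x \in X) (coloop F x).
Proof. exact: forall_inP. Qed.

Lemma coloopPn F x : reflect (exists2 X, X \in F & x \notin X) (~~ coloop F x).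
Proof.
rewrite negb_forall_in; apply: (iffP existsP) => -[X].
  by case/andP=> ? ?; exists X.
by move=> ? ?; exists X; apply/andP.
Qed.

(** A feasible set containing the coloop [x] is recovered from its trace as [x |: X], so both
    branches of [ldel] become a single membership test. *)
Lemma mem_ldel F x X :
  (X \in ldel F x) = (x \notin X) && ((if coloop F x then x |: X else X) \in F).
Proof.
rewrite /ldel; case: ifPn => [/coloopP cl|_]; last by rewrite inE andbC.
apply/imsetP/andP => [[Y YF ->]|[xX XF]].
  by rewrite setD11 setD1K // cl.
by exists (x |: X); rewrite // setU1K.
Qed.

Lemma ldel_neq0 F x : F != set0 -> ldel F x != set0.
Proof.
case/set0Pn => X XF; rewrite /ldel; case: ifPn => [_|/coloopPn[Y YF xY]].
  by apply/set0Pn; exists (X :\ x); apply/imsetP; exists X.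
by apply/set0Pn; exists Y; rewrite inE YF.
Qed.

(** Exchange [y |: X] at [y] against a feasible set missing [y]. The result misses [y], hence
    contains [x] by hypothesis, and this forces the exchange partner to be [x]: the result is
    [x |: X]. *)
Lemma ldel_exchange F x y X : x != y -> delta_matroid F ->
  ~~ coloop F y -> (forall Y, Y \in F -> x \notin Y -> y \in Y) ->
  x \notin X -> y \notin X -> y |: X \in F -> x |: X \in F.
Proof.
move=> nxy [_ exch] /coloopPn[Y YF yY] h xX yX yXF.
have yD : y \in symdiff (y |: X) Y by rewrite in_symdiff setU11 (negbTE yY).
have [v vD vF] := exch _ _ _ yXF YF yD.
have yS : y \notin symdiff (y |: X) [set y; v] by rewrite in_symdiff !inE eqxx.
have [xv|nxv] := eqVneq x v.
  rewrite -xv in vF; congr (_ \in F): vF; apply/setP => z; rewrite in_symdiff !inE.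
  have [->|nzy] /= := eqVneq z y; first by rewrite eq_sym (negbTE nxy) (negbTE yX).
  by have [->|nzx] /= := eqVneq z x; rewrite ?(negbTE xX) ?addbF.
have xS : x \notin symdiff (y |: X) [set y; v].
  by rewrite in_symdiff !inE (negbTE nxy) (negbTE nxv) (negbTE xX).
by rewrite (h _ vF xS) in yS.
Qed.

(** The substantial case is that neither element is a coloop. Then deleting one turns the other into
    a coloop exactly when no feasible set avoids both, a condition symmetric in [x] and [y]; if it
    holds, the two orders test [y |: X] and [x |: X], which [ldel_exchange] identifies. *)
Lemma ldelC F x y : delta_matroid F -> ldel (ldel F x) y = ldel (ldel F y) x.
Proof.
move=> dF; have [->//|nxy] := eqVneq x y.
have nyx : y != x by rewrite eq_sym.
have cl1 a b : coloop F b -> a != b -> coloop (ldel F a) b.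
  move=> /coloopP cb nab; apply/coloopP => X; rewrite mem_ldel => /andP[_].
  by move=> /cb; case: ifP => //; rewrite !inE eq_sym (negbTE nab).
have cl2 a b : coloop F a -> ~~ coloop F b -> a != b -> ~~ coloop (ldel F a) b.
  move=> ca /coloopPn[X XF bX] nab; apply/coloopPn; exists (X :\ a).
    by rewrite mem_ldel ca setD11 setD1K // (coloopP _ _ ca).
  by rewrite !inE (negbTE bX) andbF.
have cl3 a b : ~~ coloop F a ->
    reflect (forall X, X \in F -> a \notin X -> b \in X) (coloop (ldel F a) b).
  move=> ca; apply: (iffP (coloopP _ _)) => h X.
    by move=> XF aX; apply: h; rewrite mem_ldel aX (negbTE ca).
  by rewrite mem_ldel (negbTE ca) => /andP[aX XF]; exact: h.
apply/setP => X; rewrite !mem_ldel.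
have [xX|xX] := boolP (x \in X).
  by rewrite /=; case: ifP; rewrite ?(inE, xX, orbT, andbF).
have [yX|yX] := boolP (y \in X).
  by rewrite /=; case: ifP; rewrite ?(inE, yX, orbT, andbF).
have -> : x \notin (if coloop (ldel F x) y then y |: X else X).
  by case: ifP; rewrite ?inE (negbTE xX) ?(negbTE nxy).
have -> : y \notin (if coloop (ldel F y) x then x |: X else X).
  by case: ifP; rewrite ?inE (negbTE yX) ?(negbTE nyx).
rewrite /=; have [cx|cx] := boolP (coloop F x); have [cy|cy] := boolP (coloop F y).
- by rewrite !cl1 // setUCA.
- by rewrite (negbTE (cl2 _ _ cx cy nxy)) cl1.
- by rewrite (negbTE (cl2 _ _ cy cx nyx)) cl1.
have [h|h] := cl3 x y cx; have [h'|h'] := cl3 y x cy => //.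
- by apply/idP/idP; apply: ldel_exchange.
- by case: h' => Y YF; apply: contraNT => /h; apply.
- by case: h => Y YF; apply: contraNT => /h'; apply.
Qed.

(** Putting the coloop [x] back into both sets leaves their symmetric difference unchanged. As it
    misses [x], the exchange partner found in [F] differs from [x] and the exchange descends. *)
Lemma ldel_delta_matroid F x : delta_matroid F -> delta_matroid (ldel F x).
Proof.
move=> [F0 exch]; split; first exact: ldel_neq0.
move=> X Y u; rewrite !mem_ldel => /andP[xX XF] /andP[xY YF] uD.
have eD : symdiff (if coloop F x then x |: X else X)
    (if coloop F x then x |: Y else Y) = symdiff X Y.
  case: ifP => // _; apply/setP => z; rewrite !in_symdiff !inE.
  by have [->|//] := eqVneq z x; rewrite (negbTE xX) (negbTE xY).
rewrite -eD in uD; have [v vD vF] := exch _ _ _ XF YF uD.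
rewrite eD in uD vD; exists v => //; rewrite mem_ldel.
have xD : x \notin symdiff X Y by rewrite in_symdiff (negbTE xX) (negbTE xY).
have xuv : x \notin [set u; v].
  by apply: contra xD; rewrite in_set2 => /orP[]/eqP->.
rewrite in_symdiff (negbTE xX) (negbTE xuv) /=; congr (_ \in F): vF.
case: ifP => // _; apply/setP => z; rewrite !(in_symdiff, in_setU1 z x).
by have [->|//] := eqVneq z x; rewrite (negbTE xX) (negbTE xuv).
Qed.

Lemma foldl_delta_matroid F s : delta_matroid F -> delta_matroid (foldl ldel F s).
Proof. by elim: s F => //= x s IH F /(ldel_delta_matroid x) /IH. Qed.

Lemma dels_delta_matroid F Z : delta_matroid F -> delta_matroid (dels F Z).
Proof. exact: foldl_delta_matroid. Qed.

Lemma foldl_ldel_rem F s x : delta_matroid F -> x \in s ->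
  foldl ldel F s = foldl ldel (ldel F x) (rem x s).
Proof.
elim: s F => //= y s IH F dF; rewrite in_cons eq_sym.
case: eqVneq => [->//|nyx] /= xs.
by rewrite IH //= 1?ldelC //; exact: ldel_delta_matroid.
Qed.

(** Frees deletion from the order of [enum], which neither injections nor unions of sets respect. *)
Lemma perm_foldl_ldel F s t : delta_matroid F -> perm_eq s t ->
  foldl ldel F s = foldl ldel F t.
Proof.
elim: s t F => [|x s IH] t F dF st.
  by have /nilP -> : nilp t by rewrite /nilp -(perm_size st).
have xt : x \in t by rewrite -(perm_mem st) mem_head.
rewrite (foldl_ldel_rem dF xt) /=; apply: IH; first exact: ldel_delta_matroid.
by rewrite -(perm_cons x) (perm_trans st) // perm_to_rem.
Qed.

Lemma delsU F Y Z : delta_matroid F -> [disjoint Y & Z] ->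
  dels F (Y :|: Z) = dels (dels F Y) Z.
Proof.
move=> dF dYZ; rewrite /dels -foldl_cat; apply: perm_foldl_ldel => //.
apply: uniq_perm; first exact: enum_uniq.
  rewrite cat_uniq !enum_uniq andbT /=; apply/hasPn => x.
  by rewrite !mem_enum => xZ; rewrite (disjointFl dYZ).
by move=> x; rewrite mem_cat !mem_enum inE.
Qed.

Lemma ldel_supported F x E : supported F E -> supported (ldel F x) E.
Proof.
move=> sF X; rewrite mem_ldel => /andP[_]; case: ifP => _ /sF //.
exact/subset_trans/subsetU1.
Qed.

Lemma ldel_supportedC F x : supported (ldel F x) (~: [set x]).
Proof.
move=> X; rewrite mem_ldel => /andP[xX _].
by apply/subsetP => y yX; rewrite !inE; apply: contraNneq xX => <-.
Qed.

Lemma foldl_supported F s E : supported F E -> supported (foldl ldel F s) E.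
Proof. by elim: s F => //= x s IH F /(@ldel_supported _ x) /IH. Qed.

Lemma dels_supported F Z E : supported F E -> supported (dels F Z) E.
Proof. exact: foldl_supported. Qed.

Lemma dels_supportedC F Z : supported (dels F Z) (~: Z).
Proof.
move=> X XF; apply/subsetP => x xX; rewrite inE; apply/negP => xZ.
have : x \in enum Z by rewrite mem_enum.
move: XF xX; rewrite /dels; elim: (enum Z) F => //= y s IH F XF xX.
rewrite in_cons => /orP[/eqP xy|]; last exact: IH XF xX.
have := foldl_supported (@ldel_supportedC F y) XF.
by move=> /subsetP /(_ _ xX); rewrite xy !inE eqxx.
Qed.

Lemma dels_setC_supported F E : supported (dels F (~: E)) E.
Proof. by have := @dels_supportedC F (~: E); rewrite setCK. Qed.

Lemma supported_setT F : supported F setT.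
Proof. by move=> X _; exact: subsetT. Qed.

(** An element outside [E] lies in no feasible set and, since [F] is nonempty, is not a coloop;
    deleting it filters nothing out. *)
Lemma dels_loops F Z E : F != set0 -> supported F E -> [disjoint E & Z] ->
  dels F Z = F.
Proof.
move=> F0 sF dEZ; rewrite /dels.
have : all [pred x | x \notin E] (enum Z).
  by apply/allP => x; rewrite mem_enum => xZ; rewrite inE /= (disjointFl dEZ).
elim: (enum Z) => //= x s IH /andP[xE /IH e]; rewrite -[RHS]e; congr (foldl ldel _ s).
have xX X : X \in F -> x \notin X.
  by move=> /sF /subsetP XE; apply: contra xE => /XE.
have ncl : ~~ coloop F x.
  by case/set0Pn: F0 => X XF; apply/coloopPn; exists X; rewrite ?xX.
apply/setP => X; rewrite mem_ldel (negbTE ncl).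
by have [/xX ->|] := boolP (X \in F); rewrite ?andbF.
Qed.

(** The points of [Z :\: Y] are loops. This lets a complement in the ambient type be traded for a
    complement in the ground set. *)
Lemma dels_sub F Y Z E : delta_matroid F -> supported F E -> Y \subset Z ->
  [disjoint E & Z :\: Y] -> dels F Z = dels F Y.
Proof.
move=> dF sF sYZ dE; rewrite -(setID Z Y) (setIidPr sYZ) delsU //; last first.
  by rewrite -setI_eq0 setIC setIDAC setDIl setDv setI0.
apply: (@dels_loops _ _ E) => //; first by case: (dels_delta_matroid Y dF).
exact: dels_supported.
Qed.

Lemma dels_dels F Y Z : delta_matroid F -> Y \subset Z -> dels (dels F Y) Z = dels F Z.
Proof.
move=> dF sYZ; rewrite -{2}(setID Z Y) (setIidPr sYZ) delsU //; last first.
  by rewrite -setI_eq0 setIC setIDAC setDIl setDv setI0.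
apply: (@dels_sub _ _ _ (~: Y)).
- exact: dels_delta_matroid.
- exact: dels_supportedC.
- exact: subsetDl.
- by rewrite -setI_eq0 setDDr setDv set0U setIA [~: Y :&: Z]setIC -setIA (setIC _ Y) setICr setI0.
Qed.

Lemma ldel_even F x : (forall X Y, X \in F -> Y \in F -> odd #|X| = odd #|Y|) ->
  forall X Y, X \in ldel F x -> Y \in ldel F x -> odd #|X| = odd #|Y|.
Proof.
move=> ev X Y; rewrite !mem_ldel => /andP[xX XF] /andP[xY YF].
move: XF YF; case: ifP => _ XF YF; last exact: ev.
by have := ev _ _ XF YF; rewrite !cardsU1 xX xY /= => /negb_inj.
Qed.

End Families.

(** * Transport of families along injections *)

Definition imf (S T : finType) (g : S -> T) (F : {set {set S}}) : {set {set T}} :=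
  [set (g @: X) | X : {set S} in F].

(** For families with disjoint supports this is the direct sum, formed inside one ambient type. *)
Definition join (T : finType) (F G : {set {set T}}) : {set {set T}} :=
  [set (X :|: Y) | X : {set T} in F, Y : {set T} in G].

Section Images.
Variables (S T : finType) (g : S -> T).
Hypothesis g_inj : injective g.
Implicit Types (F G : {set {set S}}) (X Y E Z : {set S}).

Lemma mem_imf F X : (g @: X \in imf g F) = (X \in F).
Proof. exact/mem_imset/imset_inj. Qed.

Lemma imf_supported F E : supported F E -> supported (imf g F) (g @: E).
Proof. by move=> sF _ /imsetP[X XF ->]; apply/imsetS/sF. Qed.

Lemma imf_neq0 F : (imf g F != set0) = (F != set0).
Proof. by rewrite imset_eq0. Qed.

Lemma imset_setD X Y : g @: (X :\: Y) = g @: X :\: g @: Y.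
Proof.
apply/setP => x; rewrite inE; apply/imsetP/andP => [[y + ->]|[xY /imsetP[y yX e]]].
  by rewrite inE !mem_imset // => /andP[].
by exists y; rewrite // inE yX andbT -(mem_imset _ _ g_inj) -e.
Qed.

Lemma imset_symdiff X Y : g @: symdiff X Y = symdiff (g @: X) (g @: Y).
Proof. by rewrite /symdiff imsetU !imset_setD. Qed.

Lemma coloop_imf F x : coloop (imf g F) (g x) = coloop F x.
Proof.
apply/coloopP/coloopP => h X; first by move=> XF; rewrite -(mem_imset _ _ g_inj) h ?mem_imf.
by case/imsetP => Y YF ->; rewrite mem_imset // h.
Qed.

Lemma ldel_imf F x : ldel (imf g F) (g x) = imf g (ldel F x).
Proof.
apply/setP => X; rewrite mem_ldel coloop_imf; apply/andP/imsetP.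
  case=> gX; case: ifP => cl /imsetP[Y YF e].
    have xY : x \in Y by rewrite -(mem_imset _ _ g_inj) -e setU11.
    exists (Y :\ x); first by rewrite mem_ldel cl setD11 setD1K.
    by rewrite imset_setD imset_set1 -e setU1K.
  by exists Y; rewrite // mem_ldel cl YF andbT -(mem_imset _ _ g_inj) -e.
case=> Y; rewrite mem_ldel => /andP[xY YF] ->.
rewrite mem_imset // xY; split=> //.
by case: ifP YF => _ YF; rewrite -?imsetU1 mem_imf.
Qed.

Lemma delta_matroid_imf F : delta_matroid (imf g F) <-> delta_matroid F.
Proof.
split=> -[F0 exch]; split; rewrite ?imf_neq0 // -?imf_neq0 //.
- move=> X Y u XF YF uD.
  have := exch (g @: X) (g @: Y) (g u).
  rewrite !mem_imf -imset_symdiff mem_imset // => /(_ XF YF uD)[_ /imsetP[v vD ->]].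
  have -> : [set g u; g v] = g @: [set u; v] by rewrite imsetU !imset_set1.
  by rewrite -imset_symdiff mem_imf; exists v.
- move=> _ _ u /imsetP[X XF ->] /imsetP[Y YF ->].
  rewrite -imset_symdiff => /imsetP[w wD ->].
  have [v vD vF] := exch _ _ _ XF YF wD; exists (g v); first exact: imset_f.
  have -> : [set g w; g v] = g @: [set w; v] by rewrite imsetU !imset_set1.
  by rewrite -imset_symdiff mem_imf.
Qed.

Lemma dels_imf F Z : delta_matroid F -> dels (imf g F) (g @: Z) = imf g (dels F Z).
Proof.
move=> dF; transitivity (foldl (@ldel T) (imf g F) (map g (enum Z))).
  apply: perm_foldl_ldel; first exact/delta_matroid_imf.
  apply: uniq_perm; rewrite ?enum_uniq ?map_inj_uniq ?enum_uniq //.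
  by move=> x; rewrite mem_enum; apply/imsetP/mapP => -[y yZ ->]; exists y;
    rewrite ?mem_enum // -mem_enum.
rewrite /dels; elim: (enum Z) F {dF} => //= x s IH F.
by rewrite ldel_imf IH.
Qed.

End Images.

Lemma imf_comp (S T U : finType) (g : S -> T) (h : T -> U) F :
  imf h (imf g F) = imf (h \o g) F.
Proof.
rewrite /imf -imset_comp; apply: eq_imset => X /=.
by rewrite imset_comp.
Qed.

Lemma eq_imf (S T : finType) (g h : S -> T) F : g =1 h -> imf g F = imf h F.
Proof. by move=> e; apply: eq_imset => X; exact: eq_imset. Qed.

Lemma imf_id (T : finType) (F : {set {set T}}) : imf id F = F.
Proof. by rewrite /imf -[RHS]imset_id; apply: eq_imset => X; exact: imset_id. Qed.

(** * Direct sums inside an ambient type *)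

Section Join.
Variable T : finType.
Implicit Types (F G H : {set {set T}}) (E X Y Z : {set T}).

Lemma joinC F G : join F G = join G F.
Proof.
by apply/setP => X; apply/imset2P/imset2P => -[Y Z YF ZG ->]; exists Z Y;
  rewrite // setUC.
Qed.

Lemma joinA F G H : join F (join G H) = join (join F G) H.
Proof.
apply/setP => X; apply/imset2P/imset2P.
  case=> Y _ YF /imset2P[Z W ZG WH ->] ->.
  by exists (Y :|: Z) W; rewrite ?setUA //; apply/imset2P; exists Y Z.
case=> _ W /imset2P[Y Z YF ZG ->] WH ->.
by exists Y (Z :|: W); rewrite ?setUA //; apply/imset2P; exists Z W.
Qed.

Lemma join1 F : join F [set set0] = F.
Proof.
apply/setP => X; apply/imset2P/idP => [[Y Z YF /set1P-> ->]|XF]; first by rewrite setU0.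
by exists X set0; rewrite ?setU0 ?inE.
Qed.

Lemma join_supported F G E Z :
  supported F E -> supported G Z -> supported (join F G) (E :|: Z).
Proof. by move=> sF sG _ /imset2P[X Y /sF sX /sG sY ->]; exact: setUSS. Qed.

Lemma mem_join F G E Z X : supported F E -> supported G Z -> [disjoint E & Z] ->
  (X \in join F G) = [&& X \subset E :|: Z, X :&: E \in F & X :&: Z \in G].
Proof.
move=> sF sG dEZ; have EZ0 : E :&: Z = set0 by apply/disjoint_setI0.
apply/imset2P/and3P => [[Y W YF WG ->]|[sX XF XG]]; last first.
  by exists (X :&: E) (X :&: Z); rewrite // -setIUr (setIidPl sX).
have YE := sF _ YF; have WZ := sG _ WG; rewrite setUSS // !setIUl.
rewrite (setIidPl YE) (setIidPl WZ).
have -> : W :&: E = set0.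
  by apply/eqP; rewrite -subset0 -EZ0 setIC; exact: setIS.
have -> : Y :&: Z = set0 by apply/eqP; rewrite -subset0 -EZ0; exact: setSI.
by rewrite setU0 set0U.
Qed.

(** A coloop of the sum lying in [E] is a coloop of [F]: pad any [X] of [F] by a feasible set of
    [G], which cannot contain [x]. Both sides thus take the same branch of [ldel]. *)
Lemma ldel_join F G E Z x : G != set0 -> supported F E -> supported G Z ->
  [disjoint E & Z] -> x \in E -> ldel (join F G) x = join (ldel F x) G.
Proof.
move=> /set0Pn[Y YG] sF sG dEZ xE.
have xZ : x \notin Z by rewrite (disjointFr dEZ).
have cl : coloop (join F G) x = coloop F x.
  apply/coloopP/coloopP => h X.
    move=> XF; have : X :|: Y \in join F G by apply/imset2P; exists X Y.
    move=> /h; rewrite inE => /orP[//|xY].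
    by have /subsetP/(_ _ xY) := sG _ YG; rewrite (negbTE xZ).
  by case/imset2P => W W' /h xW _ ->; rewrite inE xW.
apply/setP => X; rewrite mem_ldel cl.
rewrite (mem_join _ (@ldel_supported _ _ x _ sF) sG dEZ) mem_ldel.
rewrite !inE xE andbT.
have [xX|xX] /= := boolP (x \in X); first by rewrite andbF.
case: ifP => _; rewrite (mem_join _ sF sG dEZ) // subUset !setIUl sub1set inE xE /=.
rewrite (setIidPl _) ?sub1set // [[set x] :&: Z](_ : _ = set0) ?set0U //.
by apply/eqP; rewrite setI_eq0 disjoints1.
Qed.

Lemma foldl_join F G E Z s : G != set0 -> supported F E -> supported G Z ->
  [disjoint E & Z] -> {subset s <= E} ->
  foldl (@ldel T) (join F G) s = join (foldl (@ldel T) F s) G.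
Proof.
move=> G0 + sG dEZ; elim: s F => //= x s IH F sF sE.
rewrite (@ldel_join _ _ E Z) ?IH //; first exact: ldel_supported.
  by move=> y ys; apply: sE; rewrite in_cons ys orbT.
by apply: sE; exact: mem_head.
Qed.

Lemma dels_join F G E Z X : delta_matroid (join F G) ->
  delta_matroid F -> delta_matroid G -> supported F E -> supported G Z ->
  [disjoint E & Z] -> X \subset E :|: Z ->
  dels (join F G) X = join (dels F (X :&: E)) (dels G (X :&: Z)).
Proof.
move=> dFG dF dG sF sG dEZ sX.
have dZE : [disjoint Z & E] by rewrite disjoint_sym.
rewrite -{1}(setIidPl sX) setIUr delsU //; last first.
  exact/(disjointWl (subsetIr X E))/(disjointWr (subsetIr X Z)).
have -> : dels (join F G) (X :&: E) = join (dels F (X :&: E)) G.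
  apply: (@foldl_join _ _ E Z) => //; first by case: dG.
  by move=> x; rewrite mem_enum inE => /andP[].
rewrite joinC [RHS]joinC; apply: (@foldl_join _ _ Z E) => //.
- by case: (dels_delta_matroid (X :&: E) dF).
- exact: dels_supported.
- by move=> x; rewrite mem_enum inE => /andP[].
Qed.

End Join.

(** * Isomorphism classes of families with a ground set, their products and restrictions *)

Section Keys.

Lemma relabelE n (s : {perm 'I_n}) F : relabel s F = imf s F.
Proof. by []. Qed.

Lemma iso_refl n (F : setsys n) : iso_ss F F.
Proof.
apply/existsP; exists 1%g; rewrite relabelE (eq_imf _ (@perm1 _)).
by rewrite (@imf_id 'I_n).
Qed.

Lemma iso_sym n (F G : setsys n) : iso_ss F G -> iso_ss G F.
Proof.
case/existsP => s /eqP ->; apply/existsP; exists (s^-1)%g.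
by rewrite !relabelE imf_comp (eq_imf _ (@permK _ s)) (@imf_id 'I_n).
Qed.

Lemma iso_trans n (F G H : setsys n) : iso_ss F G -> iso_ss G H -> iso_ss F H.
Proof.
case/existsP => s /eqP -> /existsP[t /eqP ->]; apply/existsP; exists (s * t)%g.
rewrite !relabelE imf_comp; apply/eqP/eq_imf => i /=.
by rewrite permM.
Qed.

Lemma iso_canon n (F : setsys n) : iso_ss F (canon F).
Proof.
rewrite /canon; case: pickP => [G|/(_ F)]; rewrite inE //=.
by rewrite iso_refl.
Qed.

(** Isomorphic families have equal classes as sets, so [pick] makes the same choice; its default is
    never reached because [G] belongs to the class. *)
Lemma canon_iso n (F G : setsys n) : iso_ss F G -> canon F = canon G.
Proof.
move=> FG; rewrite /canon.
have -> : iso_class F = iso_class G.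
  apply/setP => H; rewrite !inE.
  by apply/idP/idP; apply: iso_trans => //; exact: iso_sym.
by case: pickP => // /(_ G); rewrite inE iso_refl.
Qed.

Lemma canonK n (F : setsys n) : canon (canon F) = canon F.
Proof. exact/esym/canon_iso/iso_canon. Qed.

Lemma canonE n (F : setsys n) : exists s : {perm 'I_n}, canon F = imf s F.
Proof. by have /existsP[s /eqP] := iso_canon F; exists s. Qed.

Lemma canon_key_imf n m (F : setsys n) (h : 'I_n -> 'I_m) : injective h -> n = m ->
  canon_key (mkkey (imf h F)) = canon_key (mkkey F).
Proof.
move=> + e; case: _ / e h => h h_inj; congr mkkey; apply/esym/canon_iso/existsP.
exists (perm h_inj); apply/eqP/eq_imf => i.
by rewrite permE.
Qed.

Lemma canon_keyK k : canon_key (canon_key k) = canon_key k.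
Proof. by rewrite /canon_key /= canonK. Qed.

(* Deleted elements stay in the ambient finite type T as loops, so the ground
   set E is carried separately from the family F. *)
Definition famkey (T : finType) (E : {set T}) (F : {set {set T}}) : key :=
  canon_key (mkkey [set [set i : 'I_#|E| | enum_val i \in X] | X : {set T} in F]).

Lemma famkey_imf (S T : finType) (g : S -> T) (E : {set S}) F : injective g ->
  famkey (g @: E) (imf g F) = famkey E F.
Proof.
move=> g_inj.
(* The bijection of index ordinals that [g] induces through the two enumerations. *)
pose h (i : 'I_#|E|) : 'I_#|g @: E| :=
  enum_rank_in (imset_f g (enum_valP i)) (g (enum_val i)).
have hE i : enum_val (h i) = g (enum_val i).
  by rewrite enum_rankK_in // imset_f // enum_valP.
have h_inj : injective h.
  by move=> i j e; apply/enum_val_inj/g_inj; rewrite -!hE e.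
rewrite -[RHS](canon_key_imf _ h_inj) ?card_imset //; congr (canon_key (mkkey _)).
rewrite /imf -!imset_comp; apply: eq_imset => X /=; apply/setP => j; rewrite inE.
apply/idP/imsetP => [/imsetP[x xX jx]|[i + ->]]; last first.
  by rewrite inE hE mem_imset.
have := enum_valP j; rewrite jx mem_imset // => xE.
exists (enum_rank_in xE x); first by rewrite inE enum_rankK_in.
by apply: enum_val_inj; rewrite hE enum_rankK_in.
Qed.

Lemma famkeyT n (F : setsys n) : famkey setT F = canon_key (mkkey F).
Proof.
rewrite /famkey -(canon_key_imf _ (@enum_val_inj _ [set: 'I_n])) ?cardsT ?card_ord //.
congr (canon_key (mkkey _)); rewrite /imf -imset_comp -[RHS]imset_id.
apply: eq_imset => X /=; apply/setP => i; apply/imsetP/idP => [[j + ->]|iX].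
  by rewrite inE.
by exists (enum_rank_in (in_setT i) i); rewrite ?inE enum_rankK_in ?inE.
Qed.

Lemma famkeyTimf n (T : finType) (g : 'I_n -> T) (F : setsys n) : injective g ->
  famkey (g @: setT) (imf g F) = canon_key (mkkey F).
Proof. by move=> g_inj; rewrite famkey_imf // famkeyT. Qed.

Lemma imf_enum_val (T : finType) (E : {set T}) F : supported F E ->
  imf (@enum_val _ (mem E))
    [set [set i : 'I_#|E| | enum_val i \in X] | X : {set T} in F] = F.
Proof.
move=> sF; rewrite /imf -imset_comp -[RHS]imset_id.
apply: eq_in_imset => X /sF /subsetP XE /=; apply/setP => x.
apply/imsetP/idP => [[i + ->]|xX]; first by rewrite inE.
have xE := XE _ xX; exists (enum_rank_in xE x); rewrite ?inE enum_rankK_in //.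
Qed.

Lemma imset_enum_val (T : finType) (E : {set T}) :
  @enum_val _ (mem E) @: setT = E.
Proof.
apply/setP => x; apply/imsetP/idP => [[i _ ->]|xE]; first exact: enum_valP.
by exists (enum_rank_in xE x); rewrite ?inE // enum_rankK_in.
Qed.

(** The canonical representative differs from the enumerated family by a permutation [s], so
    enumerating after [s^-1] carries it back onto [F]. Statements about [famkey] thereby reduce to
    families on ordinals embedded in [T]. *)
Lemma famkey_rep (T : finType) (E : {set T}) F : supported F E ->
  exists n (G : setsys n) (g : 'I_n -> T),
    [/\ injective g, famkey E F = mkkey G, imf g G = F & g @: setT = E].
Proof.
move=> sF; set G0 := [set [set i : 'I_#|E| | enum_val i \in X] | X : {set T} in F].
have [s sE] := canonE G0.
have e_inj : injective (@enum_val _ (mem E) \o (s^-1)%g).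
  by apply: inj_comp; [exact: enum_val_inj|exact: perm_inj].
exists #|E|, (canon G0), (@enum_val _ (mem E) \o (s^-1)%g); split=> //.
- rewrite sE imf_comp -[RHS](imf_enum_val sF); apply: eq_imf => i /=.
  by rewrite permK.
- have sT : (s^-1)%g @: setT = setT.
    by apply/setP => i; rewrite !inE; apply/imsetP; exists (s i); rewrite ?inE ?permK.
  by rewrite imset_comp sT imset_enum_val.
Qed.

(** Disjointness of the images makes the map glued from [f] and [g] injective, and this map carries
    the ordinal direct sum onto the join. *)
Lemma key_mulE (T : finType) n m (F : setsys n) (G : setsys m)
    (f : 'I_n -> T) (g : 'I_m -> T) :
  injective f -> injective g -> [disjoint f @: setT & g @: setT] ->
  key_mul (mkkey F) (mkkey G) =
  famkey (f @: setT :|: g @: setT) (join (imf f F) (imf g G)).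
Proof.
move=> f_inj g_inj dfg.
pose h (i : 'I_(n + m)) := match split i with inl i1 => f i1 | inr i2 => g i2 end.
have hl i : h (lshift m i) = f i by rewrite /h -[lshift m i]/(unsplit (inl i)) unsplitK.
have hr i : h (rshift n i) = g i by rewrite /h -[rshift n i]/(unsplit (inr i)) unsplitK.
have nfg i j : f i <> g j.
  move=> e; have := disjointFr dfg (imset_f f (in_setT i)).
  by rewrite e imset_f ?inE.
have h_inj : injective h.
  move=> i j; rewrite -[i]splitK -[j]splitK.
  case: (split i) => i'; case: (split j) => j' /=; rewrite ?hl ?hr.
  - by move=> /f_inj ->.
  - by move=> /nfg.
  - by move=> /esym /nfg.
  - by move=> /g_inj ->.
have <- : h @: setT = f @: setT :|: g @: setT.
  apply/setP => x; rewrite inE; apply/imsetP/orP => [[i _ ->]|].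
    by rewrite /h; case: split => j; [left|right]; rewrite imset_f.
  by case=> /imsetP[i _ ->]; [exists (lshift m i)|exists (rshift n i)]; rewrite ?inE.
have -> : join (imf f F) (imf g G) = imf h (dsum F G).
  apply/setP => X; apply/imset2P/imsetP.
    case=> _ _ /imsetP[Y YF ->] /imsetP[Z ZG ->] ->.
    exists ((@lshift n m @: Y) :|: (@rshift n m @: Z)); first by apply/imset2P; exists Y Z.
    rewrite imsetU -!imset_comp.
    by congr (_ :|: _); apply: eq_imset => i /=; rewrite ?hl ?hr.
  case=> _ /imset2P[Y Z YF ZG ->] ->.
  exists (f @: Y) (g @: Z); rewrite ?imset_f //.
  rewrite imsetU -!imset_comp.
  by congr (_ :|: _); apply: eq_imset => i /=; rewrite ?hl ?hr.
by rewrite famkeyTimf.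
Qed.

Lemma key_mul_famkey (T : finType) (E Z : {set T}) F G :
  supported F E -> supported G Z -> [disjoint E & Z] ->
  key_mul (famkey E F) (famkey Z G) = famkey (E :|: Z) (join F G).
Proof.
move=> /famkey_rep[n [F' [f [f_inj -> <- <-]]]].
move=> /famkey_rep[m [G' [g [g_inj -> <- <-]]]].
exact: key_mulE.
Qed.

Definition reskey (T : finType) (F : {set {set T}}) (E : {set T}) : key :=
  famkey E (dels F (~: E)).

Lemma reskeyE n (F : setsys n) E :
  canon_key (mkkey (restrict F E)) = reskey F E.
Proof. by []. Qed.

(** The ambient complement of [g @: E] also contains the points outside the image of [g]; these are
    loops, so deleting them changes nothing. *)
Lemma reskey_imf (S T : finType) (g : S -> T) F (E : {set S}) : injective g ->
  delta_matroid F -> reskey (imf g F) (g @: E) = reskey F E.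
Proof.
move=> g_inj dF; rewrite /reskey -(famkey_imf _ _ g_inj) -dels_imf //; congr famkey.
apply: (@dels_sub _ _ _ _ (g @: setT)).
- exact/delta_matroid_imf.
- exact/imf_supported/supported_setT.
- apply/subsetP => _ /imsetP[x xE ->].
  by rewrite !inE in xE *; rewrite mem_imset.
- apply/pred0P => x /=; apply/negP => /andP[/imsetP[y _ ->]].
  by rewrite !inE !mem_imset // !inE andNb.
Qed.

Lemma reskey_dels (T : finType) (F : {set {set T}}) (E Z : {set T}) :
  delta_matroid F -> [disjoint E & Z] -> reskey (dels F Z) E = reskey F E.
Proof.
by move=> dF dEZ; rewrite /reskey dels_dels // -disjoints_subset disjoint_sym.
Qed.

Lemma reskey_id (T : finType) (F : {set {set T}}) (E : {set T}) :
  delta_matroid F -> supported F E -> reskey F E = famkey E F.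
Proof.
move=> [F0 _] sF; rewrite /reskey (dels_loops F0 sF) //.
by rewrite -setI_eq0 setICr.
Qed.

Lemma comul_key_imf n (T : finType) (G : setsys n) (g : 'I_n -> T) :
  injective g -> delta_matroid G ->
  comul_key (mkkey G) = \sum_(X : {set T} | X \subset g @: setT)
    << (reskey (imf g G) X, reskey (imf g G) (g @: setT :\: X)) >>.
Proof.
move=> g_inj dG; rewrite /comul_key /=.
rewrite [RHS](reindex_onto (fun X : {set 'I_n} => g @: X) (fun X => g @^-1: X)) /=.
  apply: eq_big => [X|X _].
    rewrite imsetS ?subsetT //=; apply/esym/eqP/setP => x.
    by rewrite inE mem_imset.
  rewrite !reskeyE -(reskey_imf X g_inj dG) -(reskey_imf (~: X) g_inj dG).
  by rewrite -setTD imset_setD.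
move=> X /subsetP sX; apply/setP => x; apply/imsetP/idP => [[y + ->]|xX].
  by rewrite inE.
by have /imsetP[y _ e] := sX _ xX; exists y; rewrite // inE -e.
Qed.

Lemma comul_famkey (T : finType) (E : {set T}) F :
  supported F E -> delta_matroid F ->
  comul_key (famkey E F) =
    \sum_(X : {set T} | X \subset E) << (reskey F X, reskey F (E :\: X)) >>.
Proof.
move=> /famkey_rep[n [F' [f [f_inj -> <- <-]]]] dF.
rewrite (comul_key_imf f_inj) //; exact/(delta_matroid_imf f_inj).
Qed.

(** Restricting to [E] and then to a subset is restricting once, because what was deleted lies
    outside the subset as well. This is the form in which iterated coproducts are expanded. *)
Lemma comul_reskey (T : finType) F (E : {set T}) : delta_matroid F ->
  comul_key (reskey F E) =
    \sum_(X : {set T} | X \subset E) << (reskey F X, reskey F (E :\: X)) >>.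
Proof.
move=> dF; rewrite comul_famkey; last exact: dels_delta_matroid.
  apply: eq_bigr => X sX; rewrite !reskey_dels //.
    by rewrite disjoints_subset setCK subsetDl.
  by rewrite disjoints_subset setCK.
exact: dels_setC_supported.
Qed.

End Keys.

(** * Nondegenerate principal minors and pivoting over the two-element field *)

Section Nondegenerate.
Variable T : finType.
Implicit Types (A B : T -> T -> 'F_2) (U X Y Z : {set T}) (v w : T -> 'F_2).

Definition symm A : Prop := forall i j, A i j = A j i.

Definition apply_adj A v i : 'F_2 := \sum_j v j * A j i.

(* The principal minor of A on U is nonzero iff mix A U is injective; composing
   the maps mix A Z and mix A (~: Z) performs a principal pivot at Z. *)
Definition mix A U v i : 'F_2 := if i \in U then apply_adj A v i else v i.

(** Quantification over [ffun] keeps membership boolean; [ndP] passes to arbitrary functions. *)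
Definition nd A : {set {set T}} :=
  [set U | [forall v : {ffun T -> 'F_2},
     [forall i, mix A U v i == 0] ==> [forall i, v i == 0]]].

Lemma eq_mix A U v w : v =1 w -> mix A U v =1 mix A U w.
Proof.
by move=> e i; rewrite /mix e /apply_adj; under eq_bigr do rewrite e.
Qed.

Lemma ndP A U :
  reflect (forall v, (forall i, mix A U v i = 0) -> forall i, v i = 0) (U \in nd A).
Proof.
rewrite inE; apply: (iffP forallP) => h v.
  move=> v0 i; have := h (finfun v); move=> /implyP hv.
  have /hv/forallP/(_ i) : [forall i, mix A U (finfun v) i == 0].
    by apply/forallP => j; rewrite (eq_mix _ _ (ffunE v)) v0.
  by rewrite ffunE => /eqP.
apply/implyP => /forallP v0; apply/forallP => i; apply/eqP/h => j.
exact/eqP.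
Qed.

Lemma mix_comb (I : finType) A U (c : I -> 'F_2) (n : I -> T -> 'F_2) i :
  mix A U (fun j => \sum_k c k * n k j) i = \sum_k c k * mix A U (n k) i.
Proof.
rewrite /mix; case: ifP => // _; rewrite /apply_adj.
under eq_bigr do rewrite mulr_suml.
rewrite exchange_big; apply: eq_bigr => k _; rewrite mulr_sumr.
by apply: eq_bigr => j _; rewrite mulrA.
Qed.

Lemma mix_sub A U v w i : mix A U (fun j => v j - w j) i = mix A U v i - mix A U w i.
Proof.
rewrite /mix; case: ifP => // _; rewrite /apply_adj -sumrB.
by apply: eq_bigr => j _; rewrite mulrBl.
Qed.

Lemma mix_inj A U v w : U \in nd A -> mix A U v =1 mix A U w -> v =1 w.
Proof.
move=> /ndP h e i; apply/eqP; rewrite -subr_eq0; apply/eqP.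
by apply: (h (fun j => v j - w j)) => j; rewrite mix_sub e subrr.
Qed.

Definition delta_vec (k i : T) : 'F_2 := (i == k)%:R.

Lemma sum_delta v k : \sum_i v i * delta_vec k i = v k.
Proof.
rewrite (bigD1 k) //= /delta_vec eqxx mulr1 big1 ?addr0 // => i /negbTE ->.
by rewrite mulr0.
Qed.

Lemma sum_delta_r v i : \sum_k v k * delta_vec k i = v i.
Proof.
by rewrite -[RHS](sum_delta v i); apply: eq_bigr => k _; rewrite /delta_vec eq_sym.
Qed.

Lemma apply_delta A k i : apply_adj A (delta_vec k) i = A k i.
Proof.
rewrite -[RHS](sum_delta (A^~ i)); apply: eq_bigr => j _.
by rewrite mulrC.
Qed.

(** The vectors over ['F_2] form a finite type, so the injective map [mix A Z] is bijective by
    counting, and the basis vectors have preimages. *)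
Lemma mix_surj A Z : Z \in nd A ->
  exists n : T -> T -> 'F_2, forall k, mix A Z (n k) =1 delta_vec k.
Proof.
move=> Znd; pose m (v : {ffun T -> 'F_2}) : {ffun T -> 'F_2} := [ffun i => mix A Z v i].
have m_inj : injective m.
  move=> v w /ffunP e; apply/ffunP; apply: (mix_inj Znd) => i.
  by have := e i; rewrite !ffunE.
exists (fun k => (invF m_inj [ffun i => delta_vec k i] : {ffun T -> 'F_2})) => k i.
have := f_invF m_inj [ffun i => delta_vec k i].
by move=> /ffunP/(_ i); rewrite !ffunE.
Qed.

(** Self-adjointness of the principal pivot. Termwise the difference of the two sides is [apply_adj
    A v i * w i - v i * apply_adj A w i] up to a sign, which characteristic 2 absorbs; the sum of
    these terms vanishes by symmetry of [A]. *)
Lemma mix_pairing A Z v w : symm A ->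
  \sum_i mix A Z v i * mix A (~: Z) w i = \sum_i mix A (~: Z) v i * mix A Z w i.
Proof.
move=> sA; apply/eqP; rewrite -subr_eq0 -sumrB.
transitivity (\sum_i (apply_adj A v i * w i - v i * apply_adj A w i) == 0).
  congr (_ == 0); apply: eq_bigr => i _; rewrite /mix inE; case: ifP => //= _.
  by rewrite -[RHS](oppr_pchar2 (pchar_Fp (isT : prime 2))) opprB.
rewrite sumrB subr_eq0; apply/eqP.
transitivity (\sum_i \sum_j v j * A j i * w i).
  by apply: eq_bigr => i _; rewrite mulr_suml.
rewrite exchange_big; apply: eq_bigr => j _; rewrite mulr_sumr.
by apply: eq_bigr => i _; rewrite sA -mulrA [w i * _]mulrC.
Qed.

(** [B] is the matrix of [mix A (~: Z)] after the inverse of [mix A Z]. At each coordinate the maps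
    choose between [v] and its image under [A]; choosing by [Z] and then by [U] amounts to choosing
    by [symdiff U Z], so [mix B U] after [mix A Z] is [mix A (symdiff U Z)]. Symmetry of [B] is
    [mix_pairing] on the preimages of two basis vectors. *)
Lemma nd_pivot A Z : symm A -> Z \in nd A ->
  exists2 B, symm B & forall U, (U \in nd B) = (symdiff U Z \in nd A).
Proof.
move=> sA Znd; have [n nE] := mix_surj Znd.
pose B k i := mix A (~: Z) (n k) i.
have invE u i : mix A Z (fun j => \sum_k u k * n k j) i = u i.
  rewrite mix_comb -[RHS]sum_delta_r.
  by apply: eq_bigr => k _; rewrite nE.
have apE v i : apply_adj B (mix A Z v) i = mix A (~: Z) v i.
  rewrite -[LHS](mix_comb A (~: Z) (mix A Z v) n); apply: eq_mix.
  by apply: (mix_inj Znd) => j; exact: invE.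
have mixE U v i : mix B U (mix A Z v) i = mix A (symdiff U Z) v i.
  rewrite {1}/mix apE /mix in_symdiff inE.
  by case: (i \in U); case: (i \in Z).
exists B.
  move=> k l; rewrite /B.
  transitivity (\sum_i mix A (~: Z) (n k) i * mix A Z (n l) i).
    by rewrite -[LHS]sum_delta; apply: eq_bigr => i _; rewrite nE.
  rewrite -mix_pairing // -[RHS]sum_delta; apply: eq_bigr => i _.
  by rewrite nE mulrC.
move=> U; apply/ndP/ndP => h v hv.
  move: Znd => /ndP; apply; apply: h => i.
  by rewrite mixE.
have vE : mix A Z (fun j => \sum_k v k * n k j) =1 v by move=> i; rewrite invE.
have v0 := h (fun j => \sum_k v k * n k j).
move=> i; rewrite -vE (@eq_mix _ _ _ (fun=> 0)) => [|j].
  by rewrite /mix /apply_adj; case: ifP => // _; rewrite big1 // => j; rewrite mul0r.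
by apply: v0 => l; rewrite -mixE (eq_mix _ _ vE) hv.
Qed.

(** A vector killed by [mix A U] vanishes off [U], so only the block of the matrix on [U] is
    seen. *)
Lemma nd_local A B U : {in U &, A =2 B} -> U \in nd A -> U \in nd B.
Proof.
move=> AB /ndP h; apply/ndP => v v0; apply: h => i; rewrite -[RHS](v0 i) /mix.
case: ifP => // iU; apply: eq_bigr => j _.
have [jU|jU] := boolP (j \in U); first by rewrite AB.
by have := v0 j; rewrite /mix (negbTE jU) => ->; rewrite !mul0r.
Qed.

Lemma eq_nd_local A B U : {in U &, A =2 B} -> (U \in nd A) = (U \in nd B).
Proof.
move=> AB; apply/idP/idP; apply: nd_local => // i j iU jU.
by rewrite AB.
Qed.

Lemma nd_zero_row A U x : x \in U -> (forall j, j \in U -> A x j = 0) ->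
  (U \in nd A) = false.
Proof.
move=> xU A0; apply/negP => /ndP/(_ (delta_vec x)) h.
suff /h/(_ x)/eqP : forall i, mix A U (delta_vec x) i = 0.
  by rewrite /delta_vec eqxx oner_eq0.
move=> i; rewrite /mix; case: ifPn => [iU|iU]; first by rewrite apply_delta A0.
by rewrite /delta_vec; case: eqP iU => // ->; rewrite xU.
Qed.

Lemma set0_nd A : set0 \in nd A.
Proof. by apply/ndP => v + i => /(_ i); rewrite /mix inE. Qed.

(** With [A u u = 0] and distinct vertices the block has determinant [- A u v * A v u], whatever
    [A v v] is; for [u = v] it is the single nonzero entry [A u u]. *)
Lemma nd_pair A (u v : T) : A v u != 0 -> A u v != 0 -> (u = v \/ A u u = 0) ->
  [set u; v] \in nd A.
Proof.
move=> Avu Auv uv; apply/ndP => w w0.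
have w_out i : i \notin [set u; v] -> w i = 0.
  by move=> /negbTE iu; have := w0 i; rewrite /mix iu.
have wuv : w u = 0 /\ w v = 0.
  have := w0 u; have := w0 v; rewrite /mix !inE !eqxx orbT /=.
  rewrite /apply_adj (bigD1 u) //= => wAv; rewrite (bigD1 u) //= => wAu.
  case: uv => [uv|Auu].
    subst v; move: wAu; rewrite big1 => [|j ju]; last first.
      by rewrite w_out ?mul0r // !inE orbb.
    by rewrite addr0 => /eqP; rewrite mulf_eq0 (negbTE Auv) orbF => /eqP.
  have nvu : v != u by apply: contraNneq Avu => ->; rewrite Auu.
  have e0 k : \sum_(i | (i != u) && (i != v)) w i * A i k = 0.
    by apply: big1 => i /andP[iu iv]; rewrite w_out ?mul0r // !inE negb_or iu.
  move: wAu; rewrite Auu mulr0 add0r (bigD1 v) //= e0 addr0 => /eqP.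
  rewrite mulf_eq0 (negbTE Avu) orbF => /eqP wv.
  move: wAv; rewrite (bigD1 v) //= e0 wv mul0r !addr0 => /eqP.
  by rewrite mulf_eq0 (negbTE Auv) orbF => /eqP.
by move=> i; have [|/w_out //] := boolP (i \in [set u; v]); case: wuv;
  rewrite !inE => ? ? /orP[]/eqP->.
Qed.

(** The block-diagonal case. As the cross entries vanish, a vector killed by the map of one block is
    killed by that of the union, and a vector killed by the latter truncates to one killed on each
    block. *)
Lemma nd_union A U Z : [disjoint U & Z] ->
  (forall i j, i \in U -> j \in Z -> A i j = 0 /\ A j i = 0) ->
  (U :|: Z \in nd A) = (U \in nd A) && (Z \in nd A).
Proof.
move=> dUZ A0; apply/idP/andP => [/ndP h|[/ndP hU /ndP hZ]].
  have half U' Z' : U' :|: Z' = U :|: Z ->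
      (forall i j, i \in U' -> j \in Z' -> A i j = 0) -> U' \in nd A.
    move=> e A0'; apply/ndP => v v0; apply: h => i; rewrite /mix -e inE.
    have := v0 i; rewrite /mix; case: (i \in U') => //= vi.
    case: ifP => // iZ; apply: big1 => j _.
    have [jU|jU] := boolP (j \in U'); first by rewrite A0' ?mulr0.
    by have := v0 j; rewrite /mix (negbTE jU) => ->; rewrite mul0r.
  split; first by apply: (half _ Z) => // i j iU /(A0 _ _ iU)[].
  by apply: (half _ U); [exact: setUC|move=> i j iZ jU; have [] := A0 _ _ jU iZ].
apply/ndP => v v0.
have half U' Z' : U' :|: Z' = U :|: Z ->
    (forall i j, i \in U' -> j \in Z' -> A j i = 0) -> (forall i, i \in U' -> i \notin Z') ->
    forall i, mix A U' (fun j => if j \in U' then v j else 0) i = 0.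
  move=> e A0' dj i; rewrite /mix; case: (boolP (i \in U')) => // iU'.
  have := v0 i; rewrite /mix -e inE iU' /= => vi; rewrite -[RHS]vi.
  apply: eq_bigr => j _; case: ifP => // jU'.
  have [jZ|jZ] := boolP (j \in Z'); first by rewrite A0' ?mulr0.
  by have := v0 j; rewrite /mix -e inE jU' (negbTE jZ) /= => ->; rewrite !mul0r.
have vU i : i \in U -> v i = 0.
  move=> iU; have := hU (fun j => if j \in U then v j else 0).
  move=> /(_ (half U Z erefl _ _) i); rewrite iU; apply.
    by move=> k l kU lZ; case: (A0 _ _ kU lZ).
  by move=> k kU; rewrite (disjointFr dUZ).
have vZ i : i \in Z -> v i = 0.
  move=> iZ; have := hZ (fun j => if j \in Z then v j else 0).
  move=> /(_ (half Z U (setUC _ _) _ _) i); rewrite iZ; apply.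
    by move=> k l kZ lU; case: (A0 _ _ lU kZ).
  by move=> k kZ; rewrite (disjointFl dUZ).
move=> i; have := v0 i; rewrite /mix inE.
by case: (boolP (i \in U)) => [/vU //|_]; case: (boolP (i \in Z)) => [/vZ //|_].
Qed.

End Nondegenerate.

Lemma nd_imset (S T : finType) (g : S -> T) (A : T -> T -> 'F_2) (U : {set S}) :
  injective g ->
  (g @: U \in nd A) = (U \in nd (fun i j => A (g i) (g j))).
Proof.
move=> g_inj.
have sum_im (f : T -> 'F_2) : (forall t, t \notin g @: U -> f t = 0) ->
    \sum_t f t = \sum_s f (g s).
  move=> f0; transitivity (\sum_(t in g @: setT) f t); last first.
    rewrite big_imset; last by move=> x y _ _; exact: g_inj.
    by apply: eq_bigl => i; rewrite inE.
  rewrite (bigID (mem (g @: setT))) /= [X in _ + X]big1 ?addr0 // => t tT.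
  apply: f0; apply: contra tT; apply/subsetP/imsetS/subsetT.
apply/ndP/ndP => h v v0.
(* Extension of [v] by zero, written as a sum over the fibres of [g], which have at most one
   point. *)
- pose v' t := \sum_(s | g s == t) v s.
  have v'E s : v' (g s) = v s.
    by rewrite /v' (big_pred1 s) // => s' /=; rewrite (inj_eq g_inj).
  have v'0 t : t \notin g @: U -> v' t = 0.
    move=> tU; apply: big1 => s /eqP gs; have := v0 s; rewrite /mix ifN //.
    by rewrite -(mem_imset _ _ g_inj) gs.
  move=> i; rewrite -v'E; apply: h => t; rewrite /mix; case: ifPn => [|/v'0 //].
  case/imsetP => s sU ->; rewrite /apply_adj sum_im => [|t' /v'0 ->]; last exact: mul0r.
  have := v0 s; rewrite /mix sU => e; rewrite -[RHS]e.
  by apply: eq_bigr => s' _; rewrite v'E.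
- have v_out t : t \notin g @: U -> v t = 0.
    by move=> /negbTE tU; have := v0 t; rewrite /mix tU.
  move=> t; have [/imsetP[s sU ->]|/v_out //] := boolP (t \in g @: U).
  apply: (h (v \o g)) => i; have := v0 (g i); rewrite /mix mem_imset //.
  case: ifP => // _; rewrite /apply_adj sum_im // => t' /v_out ->.
  exact: mul0r.
Qed.

(** * Binary families: exchange, deletion and direct sum *)

Section Binary.
Variable T : finType.
Implicit Types (A B : T -> T -> 'F_2) (F G : {set {set T}}) (E U X Y Z : {set T}).

Definition based A X F : Prop :=
  symm A /\ forall Y, (Y \in F) = (symdiff Y X \in nd A).

Definition binary F : Prop := exists A X, based A X F.

Lemma symdiffK X Y : symdiff (symdiff X Y) Y = X.
Proof. by apply/setP => x; rewrite !in_symdiff -addbA addbb addbF. Qed.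

Lemma symdiffC X Y : symdiff X Y = symdiff Y X.
Proof. by apply/setP => x; rewrite !in_symdiff addbC. Qed.

Lemma symdiffXX X : symdiff X X = set0.
Proof. by apply/setP => x; rewrite in_symdiff addbb inE. Qed.

Lemma based_mem A X F : based A X F -> X \in F.
Proof. by case=> _ ->; rewrite symdiffXX set0_nd. Qed.

Lemma binary_neq0 F : binary F -> F != set0.
Proof. by case=> A [X /based_mem XF]; apply/set0Pn; exists X. Qed.

(** Pivot at [symdiff X X0], where [X0] is the given base; its minor is nondegenerate precisely
    because [X] is feasible. *)
Lemma binary_based F X : binary F -> X \in F -> exists A, based A X F.
Proof.
case=> A [X0 [sA FE]]; rewrite FE => /(nd_pivot sA)[B sB BE].
exists B; split=> // Y; rewrite BE FE.
have -> // : symdiff (symdiff Y X) (symdiff X X0) = symdiff Y X0.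
by apply/setP => x; rewrite !in_symdiff -addbA addKb.
Qed.

Lemma binary_delta_matroid F : binary F -> delta_matroid F.
Proof.
move=> bF; split=> [|X Y u XF YF]; first exact: binary_neq0.
have [A [sA FE]] := binary_based bF XF.
rewrite symdiffC; move: YF; rewrite FE => Dnd uD.
suff [v vD [Auv uv]] : exists2 v, v \in symdiff Y X & A u v != 0 /\ (u = v \/ A u u = 0).
  by exists v; rewrite // symdiffC FE symdiffK nd_pair // sA.
(* A nonzero diagonal entry lets [u] be flipped alone; otherwise a nonzero entry of row [u] inside
   the minor supplies the partner. *)
have [Auu|Auu] := eqVneq (A u u) 0; last by exists u; last by split=> //; left.
have [/existsP[v /andP[vD Auv]]|/existsPn h] :=
  boolP [exists v, (v \in symdiff Y X) && (A u v != 0)].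
  by exists v; last by split=> //; right.
rewrite (nd_zero_row uD) // in Dnd => j jD.
by apply/eqP; have := h j; rewrite jD negbK.
Qed.

Lemma binary_ldel F x : binary F -> binary (ldel F x).
Proof.
move=> bF.
have [X XF Xx] : exists2 X, X \in F & ~~ coloop F x -> x \notin X.
  case: (boolP (coloop F x)) => [_|/coloopPn[X]]; last by exists X.
  by case/set0Pn: (binary_neq0 bF) => X; exists X.
have [A [sA FE]] := binary_based bF XF.
(* The vertex [x] stays in the ambient type, so its row and column are zeroed instead of removed;
   since the new base misses [x], the zero row makes [x] a loop. *)
exists (fun i j => if (i == x) || (j == x) then 0 else A i j), (X :\ x); split.
  by move=> i j; rewrite orbC sA.
move=> Y; rewrite mem_ldel; have [xY|xY] := boolP (x \in Y).
  rewrite (@nd_zero_row _ _ _ x) //; first by rewrite in_symdiff xY !inE eqxx.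
  by move=> j _; rewrite eqxx.
have xS : x \notin symdiff (if coloop F x then x |: Y else Y) X.
  rewrite in_symdiff; case: ifPn => [/coloopP cl|/Xx /negbTE ->].
    by rewrite setU11 cl.
  by rewrite (negbTE xY).
have -> : symdiff Y (X :\ x) = symdiff (if coloop F x then x |: Y else Y) X.
  apply/setP => z; rewrite !in_symdiff in_setD1.
  have [->|zx] /= := eqVneq z x.
    by rewrite addbF (negbTE xY); apply/esym/negbTE; rewrite -in_symdiff.
  by case: ifP; rewrite // in_setU1 (negbTE zx).
rewrite /= FE; apply: eq_nd_local => i j.
move=> iS jS; case: eqVneq iS => [->|_ _]; first by rewrite (negbTE xS).
by case: eqVneq jS => [->|_ _] //=; rewrite (negbTE xS).
Qed.

Lemma binary_dels F Z : binary F -> binary (dels F Z).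
Proof. by rewrite /dels; elim: (enum Z) F => //= x s IH F /(binary_ldel x)/IH. Qed.

Lemma binary_join F G E Z : binary F -> binary G ->
  supported F E -> supported G Z -> [disjoint E & Z] -> binary (join F G).
Proof.
move=> [A [X bA]] [B [Y bB]] sF sG dEZ.
have /subsetP XE := sF _ (based_mem bA); have /subsetP YZ := sG _ (based_mem bB).
have [sA FE] := bA; have [sB GE] := bB.
(* The block sum. Entries of [A] and [B] outside their ground sets are discarded, so that points
   outside [E :|: Z] get zero rows and become loops. *)
pose C i j := if (i \in E) && (j \in E) then A i j
              else if (i \in Z) && (j \in Z) then B i j else 0.
have EZ i : i \in E -> (i \in Z) = false by move=> iE; rewrite (disjointFr dEZ).
exists C, (X :|: Y); split.
  by move=> i j; rewrite /C ![_ && (i \in _)]andbC sA sB.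
move=> W; rewrite (mem_join _ sF sG dEZ) FE GE.
have [sW|/subsetPn[x xW]] /= := boolP (W \subset E :|: Z); last first.
  rewrite inE => /norP[/negbTE xE /negbTE xZ]; rewrite (@nd_zero_row _ _ _ x) //.
    rewrite in_symdiff xW inE (contraFF (XE x)) //.
    by rewrite (contraFF (YZ x)).
  by move=> j _; rewrite /C xE xZ.
set W1 := symdiff (W :&: E) X; set W2 := symdiff (W :&: Z) Y.
have W1E i : i \in W1 -> i \in E.
  rewrite in_symdiff in_setI; apply: contraTT => nE.
  by rewrite (negbTE nE) andbF /=; apply: contra nE => /XE.
have W2Z i : i \in W2 -> i \in Z.
  rewrite in_symdiff in_setI; apply: contraTT => nZ.
  by rewrite (negbTE nZ) andbF /=; apply: contra nZ => /YZ.
have -> : symdiff W (X :|: Y) = W1 :|: W2.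
  apply/setP => i; rewrite in_symdiff (in_setU i X Y) (in_setU i W1 W2).
  rewrite !in_symdiff !in_setI.
  have [iE|iE] := boolP (i \in E).
    rewrite EZ // !andbT !andbF (contraFF (YZ i)) ?EZ //.
    by rewrite !orbF.
  have -> : (i \in X) = false by apply: contraNF iE => /XE.
  have [iZ|iZ] := boolP (i \in Z); first by rewrite !andbT andbF.
  have -> : (i \in Y) = false by apply: contraNF iZ => /YZ.
  rewrite !andbF /= addbF; apply: contraNF iZ => /(subsetP sW).
  by rewrite inE (negbTE iE).
have dW : [disjoint W1 & W2].
  by apply/pred0P => i /=; apply/negP => /andP[/W1E /EZ + /W2Z] => ->.
rewrite (nd_union dW); last first.
  move=> i j /W1E iE /W2Z jZ; rewrite /C.
  have jE : (j \in E) = false by rewrite (disjointFl dEZ).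
  by rewrite EZ // jE !andbF.
congr (_ && _).
- by apply: eq_nd_local => i j /W1E iE /W1E jE; rewrite /C iE jE.
- apply: eq_nd_local => i j /W2Z iZ /W2Z jZ; rewrite /C iZ jZ.
  by case: ifP => // /andP[/EZ]; rewrite iZ.
Qed.

End Binary.

Lemma binary_imf (S T : finType) (g : S -> T) (F : {set {set S}}) : injective g ->
  binary (imf g F) <-> binary F.
Proof.
move=> g_inj; split=> [[A [X' bA]]|[A [X [sA FE]]]].
  have /imsetP[X XF e] := based_mem bA; rewrite {}e in bA.
  case: bA => sA FE; exists (fun i j => A (g i) (g j)), X; split=> [i j|Y].
    exact: sA.
  by rewrite -(mem_imf g_inj) FE -imset_symdiff // nd_imset.
(* Extension of [A] by zero, again as fibre sums; the zero rows keep points outside the image of [g]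
   out of all feasible sets. *)
pose B t t' := \sum_(s | g s == t) \sum_(s' | g s' == t') A s s'.
have BE i j : B (g i) (g j) = A i j.
  by rewrite /B (big_pred1 i) ?(big_pred1 j) // => s /=; rewrite (inj_eq g_inj).
exists B, (g @: X); split=> [t t'|Y].
  rewrite /B exchange_big; apply: eq_bigr => s _; apply: eq_bigr => s' _.
  exact: sA.
have [/subsetP sY|/subsetPn[x xY xg]] := boolP (Y \subset g @: setT).
  have -> : Y = g @: (g @^-1: Y).
    apply/setP => x; apply/idP/imsetP => [xY|[y + ->]]; last by rewrite inE.
    by have /imsetP[y _ e] := sY _ xY; exists y; rewrite // inE -e.
  rewrite (mem_imf g_inj) -imset_symdiff // nd_imset // FE.
  by apply: eq_nd_local => i j _ _; rewrite BE.
rewrite (@nd_zero_row _ _ _ x).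
- by apply: contraNF xg => /imsetP[Z _ eY]; move: xY; rewrite eY; apply/subsetP/imsetS/subsetT.
- rewrite in_symdiff xY; apply: contra xg; apply/subsetP/imsetS/subsetT.
- by move=> j _; apply: big_pred0 => s; apply: contraNF xg => /eqP <-; rewrite imset_f.
Qed.

(** A determinant vanishes iff the left kernel is nontrivial, and [apply_adj] multiplies from the
    left; extension by zero identifies vectors indexed by [U] with vectors vanishing off [U]. *)
Lemma det_nd n (M : 'M['F_2]_n) U :
  (\det (induced_mx M U) != 0) = (U \in nd (fun i j => M i j)).
Proof.
rewrite -[in RHS](imset_enum_val U) nd_imset; last exact: enum_val_inj.
apply/idP/ndP => [/det0P h v v0 i|h].
  apply/eqP; apply: contra_notT h => vi; exists (\row_j v j).
    by apply: contraNneq vi => /rowP/(_ i); rewrite !mxE => ->.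
  apply/rowP => j; have := v0 j; rewrite /mix inE !mxE => e; rewrite -[RHS]e.
  by apply: eq_bigr => k _; rewrite !mxE.
apply/negP => /det0P[v /negP v0 vM]; apply/v0/eqP/rowP => j; rewrite mxE.
apply: (h (v 0)) => i; rewrite /mix inE; move/rowP/(_ i): vM; rewrite !mxE => e.
by rewrite -[RHS]e; apply: eq_bigr => k _; rewrite !mxE.
Qed.

Lemma mem_twist n (F : setsys n) (E Y : {set 'I_n}) :
  (Y \in twist F E) = (symdiff Y E \in F).
Proof.
apply/imsetP/idP => [[X XF ->]|YF]; first by rewrite symdiffK.
by exists (symdiff Y E); rewrite // -/(symdiff _ _) symdiffK.
Qed.

Lemma F2_nz (x : 'F_2) : (x != 0)%:R = x.
Proof.
case: x => -[|[|//]] p; last by apply: val_inj.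
by apply: val_inj.
Qed.

(** Over ['F_2] a symmetric matrix is the same as a framed graph: nonzero off-diagonal entries are
    the edges and the diagonal is the framing. The twist set plays the role of the base. *)
Lemma binary_dmP n (F : setsys n) : binary_dm F <-> binary F.
Proof.
split=> [[e [f [E' [s [/andP[/forallP se ie] ->]]]]]|[A [X [sA FE]]]].
  apply/(binary_imf _ (@perm_inj _ s)).
  exists (fun i j => framed_adj e f i j), E'; split=> [i j|Y].
    by rewrite !mxE eq_sym (eqP (forallP (se i) j)); case: eqP => // ->.
  by rewrite mem_twist inE det_nd.
exists (fun i j => (i != j) && (A i j != 0)), (fun i => A i i != 0), X, 1%g; split.
  apply/andP; split; apply/forallP => i; last by rewrite eqxx.
  by apply/forallP => j; rewrite [i == j]eq_sym sA.
rewrite relabelE (eq_imf _ (@perm1 _)) (@imf_id 'I_n).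
apply/setP => Y; rewrite mem_twist [RHS]inE det_nd FE.
apply: eq_nd_local => i j _ _; rewrite mxE.
by case: eqVneq => [->|_] /=; rewrite F2_nz.
Qed.

(** * Basis elements: closure, evenness and the monoid laws of the direct sum *)

Section BasisKeys.

Definition evenfam (T : finType) (F : {set {set T}}) : Prop :=
  forall X Y, X \in F -> Y \in F -> odd #|X| = odd #|Y|.

Lemma evenfamP n (F : setsys n) : reflect (evenfam F) (even_ss F).
Proof.
apply: (iffP forall_inP) => [h X Y XF YF|h X XF].
  by have /forall_inP/(_ Y YF)/eqP := h X XF.
by apply/forall_inP => Y YF; apply/eqP/h.
Qed.

Lemma evenfam_dels (T : finType) (F : {set {set T}}) Z : evenfam F -> evenfam (dels F Z).
Proof. by rewrite /dels; elim: (enum Z) F => //= x s IH F /(@ldel_even _ _ x)/IH. Qed.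

Lemma evenfam_imf (S T : finType) (g : S -> T) (F : {set {set S}}) : injective g ->
  evenfam (imf g F) <-> evenfam F.
Proof.
move=> g_inj; split=> h => [X Y XF YF|_ _ /imsetP[X XF ->] /imsetP[Y YF ->]].
  by rewrite -!(card_imset _ g_inj); apply: h; rewrite mem_imf.
by rewrite !card_imset //; exact: h.
Qed.

Lemma evenfam_join (T : finType) (F G : {set {set T}}) E Z : evenfam F -> evenfam G ->
  supported F E -> supported G Z -> [disjoint E & Z] -> evenfam (join F G).
Proof.
move=> eF eG sF sG dEZ _ _ /imset2P[X Y XF YG ->] /imset2P[X' Y' XF' YG' ->].
have card_join W W' : W \in F -> W' \in G -> #|W :|: W'| = (#|W| + #|W'|)%N.
  move=> WF WG; rewrite cardsU disjoint_setI0 ?cards0 ?subn0 //.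
  exact: disjointWl (sF _ WF) (disjointWr (sG _ WG) dEZ).
by rewrite !card_join // !oddD (eF _ _ XF XF') (eG _ _ YG YG').
Qed.

Lemma famkey_canonical (T : finType) (E : {set T}) F : supported F E ->
  exists n (G : setsys n) (g : 'I_n -> T),
    [/\ injective g, famkey E F = mkkey G, imf g G = F & canon G = G].
Proof.
move=> sF; have [n [G [g [g_inj e gF _]]]] := famkey_rep sF.
exists n, G, g; split=> //.
have : canon_key (mkkey G) = mkkey G by rewrite -e canon_keyK.
by move/eqP; rewrite /canon_key /mkkey /= eq_Tagged => /eqP.
Qed.

Lemma basis_famkey (T : finType) (E : {set T}) F :
  binary F -> supported F E -> basis_key (famkey E F).
Proof.
move=> bF /famkey_canonical[n [G [g [g_inj -> gF cG]]]]; split=> //=.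
by apply/binary_dmP/(binary_imf _ g_inj); rewrite gF.
Qed.

Lemma even_famkey (T : finType) (E : {set T}) F :
  binary F -> evenfam F -> supported F E -> even_key (famkey E F).
Proof.
move=> bF eF sF; split; first exact: basis_famkey.
have [n [G [g [g_inj -> gF _]]]] := famkey_canonical sF.
by apply/evenfamP/(evenfam_imf _ g_inj); rewrite gF.
Qed.

Lemma basis_reskey (T : finType) F (E : {set T}) : binary F -> basis_key (reskey F E).
Proof. by move=> bF; apply: basis_famkey; [exact: binary_dels|exact: dels_setC_supported]. Qed.

Lemma even_reskey (T : finType) F (E : {set T}) :
  binary F -> evenfam F -> even_key (reskey F E).
Proof.
move=> bF eF; apply: even_famkey; [exact: binary_dels|exact: evenfam_dels|].
exact: dels_setC_supported.
Qed.

Lemma basis_canon k : basis_key k -> canon_key k = k.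
Proof. by case: k => n F [_ /= cF]; rewrite /canon_key /= cF. Qed.

Lemma basis_binary k : basis_key k -> binary (tagged k).
Proof. by case=> /binary_dmP. Qed.

Lemma basis_embed k (T : finType) (g : 'I_(tag k) -> T) : injective g -> basis_key k ->
  [/\ k = famkey (g @: setT) (imf g (tagged k)), binary (imf g (tagged k)) &
      supported (imf g (tagged k)) (g @: setT)].
Proof.
move=> g_inj bk; split.
- by rewrite famkeyTimf // -[LHS]basis_canon //; case: k {bk g g_inj}.
- exact/binary_imf/basis_binary.
- exact/imf_supported/supported_setT.
Qed.

Lemma disjoint_imset (S S' T : finType) (f : S -> T) (g : S' -> T) (E : {set S})
    (Z : {set S'}) :
  (forall i j, f i != g j) -> [disjoint f @: E & g @: Z].
Proof.
move=> fg; apply/pred0P => x /=; apply/negP => /andP[/imsetP[i _ ->] /imsetP[j _ e]].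
by have := fg i j; rewrite e eqxx.
Qed.

Lemma inl_inj (S T : Type) : injective (@inl S T). Proof. by move=> x y []. Qed.
Lemma inr_inj (S T : Type) : injective (@inr S T). Proof. by move=> x y []. Qed.

(** Places two classes on disjoint ground sets of a sum type, where their product is a [join];
    evenness is transported along. *)
Lemma basis_pair k l : basis_key k -> basis_key l ->
  exists (T : finType) (E Z : {set T}) F G,
    [/\ k = famkey E F, l = famkey Z G & [disjoint E & Z]] /\
    [/\ binary F, binary G, supported F E & supported G Z] /\
    (even_ss (tagged k) -> evenfam F) /\ (even_ss (tagged l) -> evenfam G).
Proof.
move=> bk bl; pose T : finType := ('I_(tag k) + 'I_(tag l))%type.
have fi : injective (inl : _ -> T) by exact: inl_inj.
have gi : injective (inr : _ -> T) by exact: inr_inj.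
have [ek bF sF] := basis_embed fi bk; have [el bG sG] := basis_embed gi bl.
exists T, (inl @: setT), (inr @: setT), (imf inl (tagged k)), (imf inr (tagged l)).
by split; [split=> //; exact: disjoint_imset|split=> //; split=> /evenfamP h; exact/evenfam_imf].
Qed.

Lemma basis_key_mul k l : basis_key k -> basis_key l -> basis_key (key_mul k l).
Proof.
move=> bk bl; have [T [E [Z [F [G [[-> -> d] [[bF bG sF sG] _]]]]]]] := basis_pair bk bl.
rewrite key_mul_famkey //; apply: basis_famkey; last exact: join_supported.
exact: (binary_join bF bG sF sG).
Qed.

Lemma even_key_mul k l : even_key k -> even_key l -> even_key (key_mul k l).
Proof.
move=> [bk ek] [bl el].
have [T [E [Z [F [G [[kE lE d] [[bF bG sF sG] [+ +]]]]]]]] := basis_pair bk bl.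
move=> /(_ ek) eF /(_ el) eG; rewrite kE lE key_mul_famkey //.
apply: even_famkey; last exact: join_supported.
  exact: (binary_join bF bG sF sG).
exact: (evenfam_join eF eG sF sG).
Qed.

Lemma key_mulC k l : basis_key k -> basis_key l -> key_mul k l = key_mul l k.
Proof.
move=> bk bl; have [T [E [Z [F [G [[-> -> d] [[_ _ sF sG] _]]]]]]] := basis_pair bk bl.
rewrite key_mul_famkey // key_mul_famkey //; last by rewrite disjoint_sym.
by rewrite setUC joinC.
Qed.

Lemma key_mulA k l p : basis_key k -> basis_key l -> basis_key p ->
  key_mul (key_mul k l) p = key_mul k (key_mul l p).
Proof.
move=> bk bl bp; pose T : finType := ('I_(tag k) + ('I_(tag l) + 'I_(tag p)))%type.
pose f (i : 'I_(tag k)) : T := inl i; pose g (i : 'I_(tag l)) : T := inr (inl i).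
pose h (i : 'I_(tag p)) : T := inr (inr i).
have fi : injective f by move=> x y [].
have gi : injective g by move=> x y [].
have hi : injective h by move=> x y [].
have [ek _ sF] := basis_embed fi bk; have [el _ sG] := basis_embed gi bl.
have [ep _ sH] := basis_embed hi bp.
have dfg : [disjoint f @: setT & g @: setT] by exact: disjoint_imset.
have dfh : [disjoint f @: setT & h @: setT] by exact: disjoint_imset.
have dgh : [disjoint g @: setT & h @: setT] by exact: disjoint_imset.
rewrite ek el ep (key_mul_famkey sF sG) // (key_mul_famkey sG sH) //.
rewrite (key_mul_famkey (join_supported sF sG) sH) //; last first.
  by rewrite -setI_eq0 setIUl !disjoint_setI0 // setU0.
rewrite (key_mul_famkey sF (join_supported sG sH)) //; last first.
  by rewrite -setI_eq0 setIUr !disjoint_setI0 // setU0.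
by rewrite setUA joinA.
Qed.

Lemma set_ord0 (X : {set 'I_0}) : X = set0.
Proof. by apply/setP => -[]. Qed.

Lemma setsys0 (F : setsys 0) : F != set0 -> F = [set set0].
Proof.
case/set0Pn => X; rewrite (set_ord0 X) => F0; apply/setP => Y.
by rewrite (set_ord0 Y) F0 set11.
Qed.

Lemma basis_tag0 k : basis_key k -> tag k = 0%N -> k = unit_key.
Proof.
case: k => n F [/binary_dmP/binary_neq0 /= F0 _] n0; rewrite n0 in F F0 *.
by rewrite (setsys0 F0).
Qed.

Lemma set1_based (T : finType) : based (fun _ _ => 0) set0 [set (set0 : {set T})].
Proof.
split=> // Y; have -> : symdiff Y set0 = Y.
  by apply/setP => x; rewrite in_symdiff inE addbF.
rewrite inE; have [->|/set0Pn[x xY]] := eqVneq Y set0; first by rewrite set0_nd.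
by rewrite (nd_zero_row xY).
Qed.

Lemma set1_binary (T : finType) : binary [set (set0 : {set T})].
Proof. by exists (fun _ _ => 0), set0; exact: set1_based. Qed.

(** Realises the unit in any ambient type, so that [key_mul_famkey] covers products with it. *)
Lemma unit_keyE (T : finType) : unit_key = famkey (set0 : {set T}) [set set0].
Proof.
apply/esym/basis_tag0; last by rewrite /= cards0.
apply: basis_famkey; first exact: set1_binary.
by move=> X /set1P ->.
Qed.

Lemma even_unit_key : even_key unit_key.
Proof.
rewrite (unit_keyE 'I_0); apply: even_famkey; first exact: set1_binary.
  by move=> X Y /set1P -> /set1P ->.
by move=> X /set1P ->.
Qed.

Lemma basis_unit_key : basis_key unit_key.
Proof. by case: even_unit_key. Qed.

Lemma key_mul1 k : basis_key k -> key_mul k unit_key = k.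
Proof.
move=> bk; have id_inj : injective (id : 'I_(tag k) -> _) by [].
have [ek _ sF] := basis_embed id_inj bk.
rewrite {1}ek (unit_keyE 'I_(tag k)) key_mul_famkey //.
- by rewrite setU0 join1 -ek.
- by move=> X /set1P ->.
- by rewrite disjoint_sym -setI_eq0 set0I.
Qed.

Lemma reskey_setT k : basis_key k -> reskey (tagged k) setT = k.
Proof.
move=> bk; rewrite reskey_id; last exact: supported_setT.
  by rewrite famkeyT -[RHS]basis_canon //; case: k {bk}.
exact/binary_delta_matroid/basis_binary.
Qed.

Lemma reskey_set0 (T : finType) (F : {set {set T}}) : binary F ->
  reskey F set0 = unit_key.
Proof. by move=> bF; apply: basis_tag0; [exact: basis_reskey|rewrite /= cards0]. Qed.

(** The combinatorial core of multiplicativity of the coproduct. Once ambient complements are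
    replaced by complements in the ground sets, the deleted set splits into a part in [E] and a part
    in [Z], each acting on its own summand. *)
Lemma reskey_join (T : finType) (F G : {set {set T}}) (E Z X Y : {set T}) :
  binary F -> binary G -> supported F E -> supported G Z -> [disjoint E & Z] ->
  X \subset E -> Y \subset Z ->
  reskey (join F G) (X :|: Y) = key_mul (reskey F X) (reskey G Y).
Proof.
move=> bF bG sF sG dEZ sX sY.
have bFG := binary_join bF bG sF sG dEZ.
rewrite /reskey key_mul_famkey; [|exact: dels_setC_supported..|]; last first.
  exact: disjointWl sX (disjointWr sY dEZ).
have local (H : {set {set T}}) (W V : {set T}) : binary H -> supported H W -> V \subset W ->
    dels H (~: V) = dels H (W :\: V).
  move=> bH sH sV; apply: (@dels_sub _ _ _ _ W) => //.
  - exact: binary_delta_matroid.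
  - by rewrite setDE subsetIr.
  - rewrite disjoints_subset; apply/subsetP => x xW; rewrite !inE xW.
    by case: (x \in V).
congr famkey; rewrite (local _ (E :|: Z)) //; [|exact: join_supported|exact: setUSS].
rewrite (dels_join _ _ _ sF sG dEZ) ?subsetDl //; try exact: binary_delta_matroid.
rewrite (local F E) // (local G Z) //; congr (join (dels F _) (dels G _)).
  apply/setP => x; rewrite !inE; have [xE|//] := boolP (x \in E); last by rewrite !andbF.
  have /negbTE -> : x \notin Y by apply: contraL xE => /(subsetP sY) xZ; rewrite (disjointFl dEZ).
  by rewrite /= orbF !andbT.
apply/setP => x; rewrite !inE; have [xZ|//] := boolP (x \in Z); last by rewrite !andbF.
have /negbTE -> : x \notin X.
  by apply: contraL xZ => /(subsetP sX) xE; rewrite (disjointFr dEZ).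
by rewrite /= orbT !andbT.
Qed.

End BasisKeys.

(** * Linearity of bare functions on free modules *)

Section Linear.
Variable R : comNzRingType.

(** Linearity expressed as being the extension of the values on the basis; partial applications such
    as [mulB^~ y] can then be treated without declaring a structure for each. *)
Definition flin (K : choiceType) (M : lmodType R) (f : {freeg K / R} -> M) : Prop :=
  forall x, f x = fglift (fun k => f << k >>) x.

Lemma flin_fglift (K : choiceType) (M : lmodType R) (f : K -> M) : flin (fglift f).
Proof. by move=> x; apply: (@eq_fglift _ _ xpredT) => // k _; rewrite fgliftU1. Qed.

Lemma flin_comp (K L : choiceType) (M : lmodType R) (f : {freeg L / R} -> M)
    (g : {freeg K / R} -> {freeg L / R}) : flin f -> flin g -> flin (f \o g).
Proof.
move=> lf lg x /=; rewrite lf (lg x) fglift_linear.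
by apply: (@eq_fglift _ _ xpredT) => // k _; rewrite -lf.
Qed.

(** Checking on the generators that satisfy [P] is enough; with [P] the basis keys, the key-level
    laws become identities on [inB]. *)
Lemma flin_ext (K : choiceType) (M : lmodType R) (P : K -> Prop)
    (f g : {freeg K / R} -> M) x :
  flin f -> flin g -> supp P x -> (forall k, P k -> f << k >> = g << k >>) -> f x = g x.
Proof. by move=> -> -> Px e; exact: eq_fglift Px e. Qed.

Lemma flin_linear (K : choiceType) (M : lmodType R) (f : {linear {freeg K / R} -> M}) :
  flin f.
Proof. by move=> x; rewrite -fglift_linear fgliftU_id. Qed.

Lemma flin_id (K : choiceType) : flin (fun x : {freeg K / R} => x).
Proof. by move=> x; rewrite fgliftU_id. Qed.

End Linear.

(** * The bialgebra identities *)

Section HopfStructure.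

Lemma mulBU k l : mulB << k >> << l >> = << key_mul k l >>.
Proof. by rewrite /mulB !fgliftU1. Qed.

Lemma flin_mulBl y : flin (mulB^~ y).
Proof. exact: flin_fglift. Qed.

Lemma flin_mulBr x : flin (mulB x).
Proof.
move=> y; rewrite {1}/mulB fglift_exchange.
apply: (@eq_fglift _ _ xpredT) => // l _.
by rewrite /mulB; apply: (@eq_fglift _ _ xpredT) => // k _; rewrite fgliftU1.
Qed.

Lemma supp_mulB (P Q H : key -> Prop) x y : supp P x -> supp Q y ->
  (forall k l, P k -> Q l -> H (key_mul k l)) -> supp H (mulB x y).
Proof.
move=> Px Qy h; apply: supp_fglift Px _ => k Pk.
by apply: supp_fglift Qy _ => l Ql; apply: suppU; exact: h.
Qed.

Lemma mulB1 x : inB x -> mulB x unitB = x.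
Proof.
move=> Bx; apply: (flin_ext (flin_mulBl _) (@flin_id _ _) Bx) => k bk.
by rewrite /= mulBU key_mul1.
Qed.

Lemma mulBC x y : inB x -> inB y -> mulB x y = mulB y x.
Proof.
move=> Bx By; apply: (flin_ext (flin_mulBl y) (flin_mulBr y) Bx) => k bk.
apply: (flin_ext (flin_mulBr _) (flin_mulBl _) By) => l bl.
by rewrite /= !mulBU key_mulC.
Qed.

Lemma inB_unit : inB unitB.
Proof. exact: (suppU basis_unit_key). Qed.

Lemma inB_mul x y : inB x -> inB y -> inB (mulB x y).
Proof. move=> Bx By; exact: supp_mulB Bx By basis_key_mul. Qed.

Lemma mulBA x y z : inB x -> inB y -> inB z ->
  mulB (mulB x y) z = mulB x (mulB y z).
Proof.
move=> Bx By Bz.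
apply: (flin_ext (flin_comp (flin_mulBl z) (flin_mulBl y)) (flin_mulBl _) Bx) => k bk /=.
apply: (flin_ext (flin_comp (flin_mulBl z) (flin_mulBr _))
          (flin_comp (flin_mulBr _) (flin_mulBl z)) By) => l bl /=.
apply: (flin_ext (flin_mulBr _) (flin_comp (flin_mulBr _) (flin_mulBr _)) Bz) => p bp /=.
by rewrite !mulBU key_mulA.
Qed.

Lemma comulBU k : comulB << k >> = comul_key k.
Proof. exact: fgliftU1. Qed.

Lemma flin_comulB : flin comulB.
Proof. exact: flin_fglift. Qed.

Lemma comul_keyE k : comul_key k =
  \sum_(X : {set 'I_(tag k)}) << (reskey (tagged k) X, reskey (tagged k) (~: X)) >>.
Proof. by []. Qed.

Lemma supp_comul_key (P : key -> Prop) k :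
  (forall X, P (reskey (tagged k) X)) -> supp (fun p => P p.1 /\ P p.2) (comul_key k).
Proof. by move=> Pk; apply: supp_sum => X _; apply: suppU; split; exact: Pk. Qed.

Lemma inB2_comul x : inB x -> inB2 (comulB x).
Proof.
move=> Bx; apply: supp_fglift Bx _ => k bk; apply: supp_comul_key => X.
exact/basis_reskey/basis_binary.
Qed.

Lemma counitBU k : counitB << k >> = if tag k == 0%N then 1 else 0.
Proof. exact: (fgliftU1 (M := CC^o)). Qed.

Lemma flin_counitB : flin (counitB : _ -> CC^o).
Proof. exact: flin_fglift. Qed.

(** Both sides run over ordered partitions of the ground set into three blocks. The left side
    encodes them as [Y], [X :\: Y], [~: X] with [Y] inside [X], the right side as [X], [Y] and the
    rest with [Y] inside [~: X]. *)
Lemma comulB_coassoc x : inB x -> comul_id (comulB x) = id_comul (comulB x).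
Proof.
move=> Bx; apply: (flin_ext (flin_comp (flin_fglift _) flin_comulB)
  (flin_comp (flin_fglift _) flin_comulB) Bx) => k bk /=.
have dk := binary_delta_matroid (basis_binary bk).
rewrite comulBU comul_keyE /comul_id /id_comul !fglift_sumU /=.
under eq_bigr => X _ do rewrite comulBU comul_reskey // fglift_sumU /=.
under [RHS]eq_bigr => X _ do
  rewrite /tens fgliftU1 comulBU comul_reskey // fglift_sumU.
rewrite !pair_big_dep /=.
rewrite (reindex_onto (fun p => (p.1 :|: p.2, p.1)) (fun p => (p.2, p.1 :\: p.2))) /=.
  apply: eq_big => [[X Y]|[X Y]] /=.
    rewrite subsetUl xpair_eqE eqxx /= setDUl setDv set0U setDE.
    exact: (sameP eqP setIidPl).
  rewrite subsetUl xpair_eqE eqxx /= => /eqP ->.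
  by rewrite setCU -setDE.
by move=> [X Y] /= sYX; rewrite -{2}(setID X Y) (setIidPr sYX).
Qed.

Lemma comulB_counit x : inB x ->
  counit_id (comulB x) = x /\ id_counit (comulB x) = x.
Proof.
move=> Bx; split.
  apply: (flin_ext (flin_comp (flin_fglift _) flin_comulB) (@flin_id _ _) Bx) => k bk /=.
  rewrite comulBU comul_keyE fglift_sumU (bigD1 set0) //= big1 => [|X X0].
    by rewrite counitBU /= cards0 eqxx scale1r addr0 setC0 reskey_setT.
  by rewrite counitBU /= cards_eq0 (negbTE X0) scale0r.
apply: (flin_ext (flin_comp (flin_fglift _) flin_comulB) (@flin_id _ _) Bx) => k bk /=.
rewrite comulBU comul_keyE fglift_sumU (bigD1 setT) //= big1 => [|X XT].
  by rewrite counitBU /= setCT cards0 eqxx scale1r addr0 reskey_setT.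
by rewrite counitBU /= cards_eq0 -(@setCT _) (inj_eq (@setC_inj _)) (negbTE XT) scale0r.
Qed.

Lemma comulB_cocomm x : inB x -> flip2 (comulB x) = comulB x.
Proof.
move=> Bx; apply: (flin_ext (flin_comp (flin_fglift _) flin_comulB) flin_comulB Bx) => k bk /=.
rewrite comulBU comul_keyE /flip2 fglift_sumU /= (reindex_inj (@setC_inj _)) /=.
by apply: eq_bigr => X _; rewrite setCK.
Qed.

Lemma mul2_sumU (I J : finType) (P : pred I) (Q : pred J) (p : I -> key * key)
    (q : J -> key * key) :
  mul2 (\sum_(i | P i) << p i >>) (\sum_(j | Q j) << q j >>) =
  \sum_(i | P i) \sum_(j | Q j)
    << (key_mul (p i).1 (q j).1, key_mul (p i).2 (q j).2) >>.
Proof.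
rewrite /mul2 fglift_sumU; apply: eq_bigr => i _; rewrite fglift_sumU.
by apply: eq_bigr => j _; rewrite !mulBU /tens !fgliftU1.
Qed.

Lemma flin_mul2l Y : flin (mul2^~ Y).
Proof. exact: flin_fglift. Qed.

Lemma flin_mul2r X : flin (mul2 X).
Proof.
move=> Y; rewrite {1}/mul2 fglift_exchange.
apply: (@eq_fglift _ _ xpredT) => // p _.
by rewrite /mul2; apply: (@eq_fglift _ _ xpredT) => // q _; rewrite fgliftU1.
Qed.

Lemma comulB_mul x y : inB x -> inB y -> comulB (mulB x y) = mul2 (comulB x) (comulB y).
Proof.
move=> Bx By.
apply: (flin_ext (flin_comp flin_comulB (flin_mulBl y))
  (flin_comp (flin_mul2l (comulB y)) flin_comulB) Bx) => k bk /=.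
apply: (flin_ext (flin_comp flin_comulB (flin_mulBr _))
  (flin_comp (flin_mul2r _) flin_comulB) By) => l bl /=.
have [T [E [Z [F [G [[-> -> d] [[bF bG sF sG] _]]]]]]] := basis_pair bk bl.
have dF := binary_delta_matroid bF; have dG := binary_delta_matroid bG.
have bJ := binary_join bF bG sF sG d.
rewrite mulBU key_mul_famkey // !comulBU !comul_famkey //; last 2 first.
- exact: join_supported.
- exact: binary_delta_matroid.
rewrite mul2_sumU pair_big /=.
(* A subset of [E :|: Z] is the same as the pair of its traces on [E] and [Z]. *)
rewrite (reindex_onto (fun p : {set T} * {set T} => p.1 :|: p.2)
  (fun X => (X :&: E, X :&: Z))) /=; last first.
  by move=> X sX; rewrite -setIUr; apply/setIidPl.
have EZ0 : E :&: Z = set0 by exact: disjoint_setI0.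
have parts (X Y : {set T}) : X \subset E -> Y \subset Z ->
    (X :|: Y) :&: E = X /\ (X :|: Y) :&: Z = Y.
  move=> sX sY; rewrite !setIUl (setIidPl sX) (setIidPl sY).
  have -> : Y :&: E = set0 by apply/eqP; rewrite -subset0 -EZ0 setIC setIS.
  have -> : X :&: Z = set0 by apply/eqP; rewrite -subset0 -EZ0 setSI.
  by rewrite setU0 set0U.
apply: eq_big => [[X Y]|[X Y]] /=.
  apply/andP/andP => [[_ /eqP[<- <-]]|[sX sY]]; first by rewrite !subsetIr.
  by have [-> ->] := parts _ _ sX sY; rewrite setUSS.
move=> /andP[_ /eqP[eX eY]].
have sX : X \subset E by rewrite -eX subsetIr.
have sY : Y \subset Z by rewrite -eY subsetIr.
rewrite (reskey_join bF bG sF sG d sX sY).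
rewrite -(reskey_join bF bG sF sG d (subsetDl E X) (subsetDl Z Y)).
have -> // : (E :|: Z) :\: (X :|: Y) = (E :\: X) :|: (Z :\: Y).
apply/setP => z; rewrite !inE.
case: (boolP (z \in E)) => [zE|zE]; rewrite ?andbF ?orbF ?orbT ?andbT.
  have /negbTE -> : z \notin Y by apply: contraL zE => /(subsetP sY) zZ; rewrite (disjointFl d).
  by rewrite orbF (disjointFr d) // andbF orbF.
have /negbTE -> : z \notin X by apply: contra zE; exact/subsetP.
by [].
Qed.

Lemma comulB_unit : comulB unitB = tens unitB unitB.
Proof.
rewrite /unitB comulBU comul_keyE (big_pred1 set0) => [|X]; last by rewrite (set_ord0 X) /= eqxx.
rewrite /tens !fgliftU1 reskey_set0; last exact: basis_binary basis_unit_key.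
by rewrite [~: _]set_ord0 reskey_set0 //; exact: basis_binary basis_unit_key.
Qed.

Lemma counitB_mul x y : inB x -> inB y -> counitB (mulB x y) = counitB x * counitB y.
Proof.
move=> Bx By.
have lr (c : CC) : flin (fun z => (c * counitB z : CC^o)).
  by move=> z; rewrite [RHS](fgliftZf (M := CC^o)) -flin_counitB.
have ll (c : CC) : flin (fun z => (counitB z * c : CC^o)).
  move=> z; rewrite mulrC [LHS]lr.
  by apply: (@eq_fglift _ _ xpredT) => // k _; rewrite mulrC.
apply: (flin_ext (flin_comp flin_counitB (flin_mulBl y)) (ll _) Bx) => k bk /=.
apply: (flin_ext (flin_comp flin_counitB (flin_mulBr _)) (lr _) By) => l bl /=.
rewrite mulBU !counitBU /= addn_eq0.
by case: eqP => _; case: eqP => _ /=; rewrite ?(mul1r, mul0r, mulr0).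
Qed.

Lemma counitB_unit : counitB unitB = 1.
Proof. by rewrite counitBU. Qed.

End HopfStructure.

(** * The antipode and the even part *)

Section Antipode.

(** The term [X = setT] has the unit as second factor and so equals [S << k >>]; all others involve
    [S] on smaller ground sets only. The left antipode identity can thus be solved for
    [S << k >>]. *)
Lemma mul_S_id_comul (S : V -> V) k : basis_key k -> inB (S << k >>) ->
  mul_S_id S (comul_key k) = S << k >> +
    \sum_(X : {set 'I_(tag k)} | X != setT)
      mulB (S << reskey (tagged k) X >>) << reskey (tagged k) (~: X) >>.
Proof.
move=> bk BS; rewrite comul_keyE /mul_S_id fglift_sumU (bigD1 setT) //=; congr (_ + _).
rewrite reskey_setT // setCT reskey_set0; last exact: basis_binary.
exact: mulB1.
Qed.

Lemma flin_mul_S_id (S : V -> V) : flin (mul_S_id S).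
Proof. exact: flin_fglift. Qed.

Lemma card_properT n (X : {set 'I_n}) : X != setT -> (#|X| < n)%N.
Proof. by rewrite -properT => /proper_card; rewrite cardsT card_ord. Qed.

(* Solves the left antipode identity for its term X = E; n is fuel exceeding
   the size of the ground set. *)
Fixpoint antipode_key (n : nat) (k : key) : V :=
  if n is m.+1 then
    (if tag k == 0%N then 1 else 0 : CC) *: unitB -
    \sum_(X : {set 'I_(tag k)} | X != setT)
      mulB (antipode_key m (reskey (tagged k) X)) << reskey (tagged k) (~: X) >>
  else 0.

(** Reconciles the fuel [tag k] of the recursive calls with the fuel that [antipode] gives to each
    smaller restriction. *)
Lemma antipode_key_stable n m k : (tag k < n)%N -> (tag k < m)%N ->
  antipode_key n k = antipode_key m k.
Proof.
elim: n m k => [|n IH] [|m] k //= kn km; congr (_ - _).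
apply: eq_bigr => X /card_properT Xk; congr mulB; apply: IH => /=.
  exact: leq_trans Xk kn.
exact: leq_trans Xk km.
Qed.

Lemma inB_antipode_key n k : basis_key k -> inB (antipode_key n k).
Proof.
elim: n k => [|n IH] k bk /=; first exact: supp0.
apply: suppD; first by apply: suppZ; exact: inB_unit.
apply: suppN; apply: supp_sum => X _; have bF := basis_binary bk.
apply: inB_mul; [by apply: IH; exact: basis_reskey|apply: suppU; exact: basis_reskey].
Qed.

Definition antipode : {linear V -> V} := fglift (fun k => antipode_key (tag k).+1 k).

Lemma antipodeU k : antipode << k >> = antipode_key (tag k).+1 k.
Proof. exact: fgliftU1. Qed.

Lemma inB_antipode x : inB x -> inB (antipode x).
Proof. by move=> Bx; apply: supp_fglift Bx _ => k /inB_antipode_key; apply. Qed.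

Lemma flin_scale_unit : flin (fun x => counitB x *: unitB).
Proof.
move=> x; rewrite /counitB !fglift_sumE scaler_suml; apply: eq_bigr => k _.
by rewrite scalerA fgliftU1.
Qed.

Lemma antipode_left x : inB x -> mul_S_id antipode (comulB x) = counitB x *: unitB.
Proof.
move=> Bx; apply: (flin_ext (flin_comp (@flin_mul_S_id _) flin_comulB) flin_scale_unit Bx).
move=> k bk /=; rewrite comulBU mul_S_id_comul //; last by apply: inB_antipode; exact: suppU.
rewrite counitBU antipodeU /= -[RHS]addr0 -addrA; congr (_ + _).
rewrite addrC; apply/eqP; rewrite subr_eq0; apply/eqP/eq_bigr => X XT.
rewrite antipodeU; congr mulB; apply: antipode_key_stable => //=.
exact: card_properT.
Qed.

(** Commutativity converts the right convolution into the left one of the flipped tensor. Coproducts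
    are invariant under the flip, so a left antipode is also a right one. *)
Lemma mul_id_S_flip (S : V -> V) Y : (forall x, inB x -> inB (S x)) -> inB2 Y ->
  mul_id_S S Y = mul_S_id S (flip2 Y).
Proof.
move=> BS BY; apply: (flin_ext (flin_fglift _) (flin_comp (flin_fglift _) (flin_fglift _)) BY).
move=> p [b1 b2] /=; rewrite /mul_id_S /mul_S_id /flip2 !fgliftU1 /=.
by apply: mulBC; [exact: suppU|apply: BS; exact: suppU].
Qed.

Lemma antipode_right x : inB x -> mul_id_S antipode (comulB x) = counitB x *: unitB.
Proof.
move=> Bx; rewrite mul_id_S_flip; [|exact: inB_antipode|exact: inB2_comul].
by rewrite comulB_cocomm // antipode_left.
Qed.

Lemma inBe_mul x y : inBe x -> inBe y -> inBe (mulB x y).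
Proof. by move=> Ex Ey; exact: supp_mulB Ex Ey even_key_mul. Qed.

Lemma even_tagged k : even_key k -> evenfam (tagged k).
Proof. by case=> _ /evenfamP. Qed.

Lemma inBe_antipode (S : {linear V -> V}) :
  (forall x, inB x -> inB (S x)) ->
  (forall x, inB x -> mul_S_id S (comulB x) = counitB x *: unitB) ->
  forall x, inBe x -> inBe (S x).
Proof.
move=> BS antiS x Ex; rewrite flin_linear; apply: supp_fglift Ex _ => k.
have [n] := ubnP (tag k); elim: n k => // n IH k; rewrite ltnS => kn ek.
have bk : basis_key k by case: ek.
have := antiS _ (suppU (P := basis_key) bk).
rewrite comulBU mul_S_id_comul //; last by apply: BS; exact: suppU.
(* Solving for [S << k >>] leaves the unit and products of even restrictions with values of [S] on
   smaller even classes. *)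
move=> /(canRL (addrK _)) ->; apply: suppD; first by apply: suppZ; exact: (suppU even_unit_key).
apply: suppN; apply: supp_sum => X /card_properT Xk.
have eR Y : even_key (reskey (tagged k) Y).
  exact: even_reskey (basis_binary bk) (even_tagged ek).
by apply: inBe_mul; [apply: IH => //; exact: leq_trans Xk kn|exact: suppU].
Qed.

End Antipode.

Theorem theorem3p8 : graded_comm_cocomm_hopf /\ even_hopf_subalgebra.
Proof.
split; last first.
  split; first exact: (suppU even_unit_key).
  split; first exact: inBe_mul.
  split.
    move=> x Ex; apply: supp_fglift Ex _ => k ek; apply: supp_comul_key => X.
    by apply: even_reskey (even_tagged ek); apply: basis_binary; case: ek.
  move=> S BS antiS; apply: inBe_antipode => // x /antiS[] //.
split; first exact: inB_unit.
split; first exact: inB_mul.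
split; first exact: inB2_comul.
split.
  by apply: (suppU (P := fun k => basis_key k /\ tag k = 0%N)); split=> //; exact: basis_unit_key.
split.
  move=> m n x y Bx By; apply: (supp_mulB Bx By) => k l [bk <-] [bl <-].
  by split=> //; exact: basis_key_mul.
split.
  move=> n x Bx; apply: (supp_fglift Bx) => k [_ <-].
  apply: supp_sum => X _; apply: suppU => /=.
  rewrite -[RHS](card_ord (tag k)) -(cardC X); congr (_ + _)%N.
  by apply: eq_card => i; rewrite !inE.
split.
  move=> n x n0 Bx; rewrite flin_counitB (eq_fglift (g := fun=> 0 : CC^o) Bx) ?fglift0 //.
  by move=> k [_ kn]; rewrite counitBU kn; case: n n0 {Bx kn}.
split; first exact: mulBA.
split.
  move=> x Bx; rewrite mulB1 //; split=> //.
  by rewrite mulBC ?mulB1 //; exact: inB_unit.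
split; first exact: mulBC.
split; first exact: comulB_coassoc.
split; first exact: comulB_counit.
split; first exact: comulB_cocomm.
split; first exact: comulB_mul.
split; first exact: comulB_unit.
split; first exact: counitB_mul.
split; first exact: counitB_unit.
exists antipode; split; first exact: inB_antipode.
by move=> x Bx; rewrite antipode_left // antipode_right.
Qed.
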